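(* Let $n=2k$ with $k\ge1$, let $V=\mathbb{C}^{n}$ be the standard $\mathrm{GL}(n,\mathbb{C})$-module and let $W=\Lambda(\Lambda^2V)$. Then $$H(W^{\mathrm{Sp}(2k)},t)=1+t+\sum_{\substack{p=2\\ p\text{ even}}}^{n-1}t^{\frac{p(p+1)}{2}}\left(\sum_{\substack{a_1+\cdots+a_{p/2}\le n-p-1\\ a_1,\ldots,a_{(p-2)/2}\text{ even},\ a_{p/2}\text{ odd}}}t^{2a_1+4a_2+\cdots+p\,a_{p/2}}\right)+\sum_{\substack{p=3\\ p\text{ odd}}}^{n-1}t^{\frac{p(p+1)}{2}}\left(\sum_{\substack{a_1+\cdots+a_{(p-1)/2}\le n-p-1\\ a_1,\ldots,a_{(p-1)/2}\text{ even}}}t^{2a_1+4a_2+\cdots+(p-1)a_{(p-1)/2}}\right),$$ where the inner sums run over tuples of non-negative integers $a_i$ satisfying the indicated conditions.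
   Context: $\Lambda^2V$ is the second exterior power of $V$. $\Lambda(\Lambda^2V)=\bigoplus_{i\ge0}\Lambda^i(\Lambda^2V)$ is the exterior algebra of $\Lambda^2V$, with the induced action of $\mathrm{GL}(n,\mathbb{C})$ and hence of the complex symplectic group $\mathrm{Sp}(2k)\subset\mathrm{GL}(2k,\mathbb{C})$. The Hilbert series is $H(\Lambda(\Lambda^2V)^{G},t)=\sum_{i\ge0}\dim\bigl(\Lambda^i(\Lambda^2V)^{G}\bigr)t^i$. Empty sums are $0$. *)

(* Defs.v *)
From HB Require Import structures.
From mathcomp Require Import boolp classical_sets.
From mathcomp Require Import all_boot all_order all_algebra all_field.

Set Implicit Arguments.
Unset Strict Implicit.
Unset Printing Implicit Defensive.

Import GRing.Theory.
Local Open Scope ring_scope.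

(* The Grassmann algebra on m generators: [gbasis A] is the product, in
   increasing order, of the generators indexed by A, and [wsign A B] is the sign
   of the shuffle sorting A followed by B (0 if A and B meet). *)
Definition grassmann (F : fieldType) (m : nat) := {ffun {set 'I_m} -> F^o}.

Section Grassmann.
Variables (F : fieldType) (m : nat).
Implicit Types (A B C S T : {set 'I_m}) (i j : 'I_m).
Local Notation G := (grassmann F m).

HB.instance Definition _ := Vector.copy G {ffun {set 'I_m} -> F^o}.
Implicit Types x y z : G.

Definition ninv A B : nat := \sum_(i in A) \sum_(j in B) (j < i)%N.

Definition wsign A B : F :=
  if [disjoint A & B] then (-1) ^+ ninv A B else 0.

Definition gbasis A : G := [ffun S => (S == A)%:R : F^o].

Definition gmul x y : G :=
  \sum_A \sum_B (x A * y B * wsign A B) *: gbasis (A :|: B).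

Lemma gbasisE x : x = \sum_A (x A : F) *: gbasis A.
Proof.
apply/ffunP => S; rewrite sum_ffunE (bigD1 S) //= !ffunE eqxx.
rewrite big1 ?addr0 => [|A neA].
  by rewrite /GRing.scale /= mulr1.
by rewrite !ffunE eq_sym (negPf neA) scaler0.
Qed.

Lemma gmulE A B : gmul (gbasis A) (gbasis B) = wsign A B *: gbasis (A :|: B).
Proof.
rewrite /gmul (bigD1 A) //= [X in _ + X]big1 ?addr0 => [|S neS]; last first.
  by apply: big1 => T _; rewrite !ffunE (negPf neS) !mul0r scale0r.
rewrite (bigD1 B) //= [X in _ + X]big1 ?addr0 => [|S neS]; last first.
  by rewrite !ffunE (negPf neS) mulr0 mul0r scale0r.
by rewrite !ffunE !eqxx !mul1r.
Qed.

Lemma gmulDl : left_distributive gmul +%R.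
Proof.
move=> x y z; rewrite /gmul -big_split; apply: eq_bigr => A _ /=.
rewrite -big_split; apply: eq_bigr => B _ /=.
by rewrite -scalerDl !ffunE !mulrDl.
Qed.

Lemma gmulDr : right_distributive gmul +%R.
Proof.
move=> x y z; rewrite /gmul -big_split; apply: eq_bigr => A _ /=.
rewrite -big_split; apply: eq_bigr => B _ /=.
by rewrite -scalerDl !ffunE mulrDr mulrDl.
Qed.

Lemma gmulZl a x y : gmul (a *: x) y = a *: gmul x y.
Proof.
rewrite /gmul scaler_sumr; apply: eq_bigr => A _ /=.
rewrite scaler_sumr; apply: eq_bigr => B _ /=.
by rewrite scalerA !ffunE /GRing.scale /= !mulrA.
Qed.

Lemma gmulZr a x y : gmul x (a *: y) = a *: gmul x y.
Proof.
rewrite /gmul scaler_sumr; apply: eq_bigr => A _ /=.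
rewrite scaler_sumr; apply: eq_bigr => B _ /=.
by rewrite scalerA !ffunE /GRing.scale /= !mulrA [x A * a]mulrC.
Qed.

Lemma gmul_suml (I : Type) (r : seq I) (f : I -> G) y :
  gmul (\sum_(i <- r) f i) y = \sum_(i <- r) gmul (f i) y.
Proof.
elim: r => [|i r IH]; last by rewrite !big_cons gmulDl IH.
by rewrite !big_nil -{1}(scale0r (0 : G)) gmulZl scale0r.
Qed.

Lemma gmul_sumr (I : Type) (r : seq I) (f : I -> G) y :
  gmul y (\sum_(i <- r) f i) = \sum_(i <- r) gmul y (f i).
Proof.
elim: r => [|i r IH]; last by rewrite !big_cons gmulDr IH.
by rewrite !big_nil -{1}(scale0r (0 : G)) gmulZr scale0r.
Qed.

Lemma ninvUl A B C :
  [disjoint A & B] -> ninv (A :|: B) C = (ninv A C + ninv B C)%N.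
Proof.
by move=> dAB; rewrite /ninv -bigU //; apply: eq_bigl => i; rewrite !inE.
Qed.

Lemma ninvUr A B C :
  [disjoint B & C] -> ninv A (B :|: C) = (ninv A B + ninv A C)%N.
Proof.
move=> dBC; rewrite /ninv -big_split; apply: eq_bigr => i _ /=.
by rewrite -bigU //; apply: eq_bigl => k; rewrite !inE.
Qed.

Lemma wsignA A B C :
  wsign A B * wsign (A :|: B) C = wsign B C * wsign A (B :|: C).
Proof.
rewrite /wsign.
have -> : [disjoint A :|: B & C] = [disjoint A & C] && [disjoint B & C].
  by rewrite -!setI_eq0 setIUl setU_eq0.
have -> : [disjoint A & B :|: C] = [disjoint A & B] && [disjoint A & C].
  by rewrite -!setI_eq0 setIUr setU_eq0.
have [dAB|] := boolP [disjoint A & B]; last by rewrite mul0r mulr0.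
have [dBC|] := boolP [disjoint B & C]; last by rewrite andbF mul0r mulr0.
have [dAC|] := boolP [disjoint A & C]; last by rewrite !mulr0.
rewrite -!exprD ninvUl // ninvUr //; congr (_ ^+ _).
by rewrite addnA [RHS]addnC.
Qed.

Lemma gmulA : associative gmul.
Proof.
move=> x y z.
pose X A := (x A : F) *: gbasis A; pose Y A := (y A : F) *: gbasis A.
pose Z A := (z A : F) *: gbasis A.
have ex : x = \sum_A X A := gbasisE x; have ey : y = \sum_A Y A := gbasisE y.
have ez : z = \sum_A Z A := gbasisE z.
have -> : gmul x (gmul y z) =
    \sum_A \sum_B \sum_C gmul (X A) (gmul (Y B) (Z C)).
  rewrite {1}ex (gmul_suml _ X); apply: eq_bigr => A _.
  rewrite {1}ey (gmul_suml _ Y) gmul_sumr; apply: eq_bigr => B _.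
  by rewrite {1}ez (gmul_sumr _ Z) gmul_sumr.
have -> : gmul (gmul x y) z =
    \sum_A \sum_B \sum_C gmul (gmul (X A) (Y B)) (Z C).
  rewrite {1}ex (gmul_suml _ X y) gmul_suml; apply: eq_bigr => A _.
  rewrite {1}ey (gmul_sumr _ Y (X A)) gmul_suml; apply: eq_bigr => B _.
  by rewrite {1}ez (gmul_sumr _ Z).
apply: eq_bigr => A _; apply: eq_bigr => B _; apply: eq_bigr => C _.
rewrite !(gmulZl, gmulZr, gmulE) !scalerA setUA; congr (_ *: _).
by rewrite -!mulrA wsignA; rewrite [RHS]mulrCA; congr (_ * _); rewrite mulrCA.
Qed.

Lemma wsign0l A : wsign set0 A = 1.
Proof. by rewrite /wsign -setI_eq0 set0I eqxx /ninv big_set0. Qed.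

Lemma wsign0r A : wsign A set0 = 1.
Proof.
rewrite /wsign -setI_eq0 setI0 eqxx /ninv big1 // => i _.
by rewrite big_set0.
Qed.

Lemma gmul1l : left_id (gbasis set0) gmul.
Proof.
move=> x; rewrite {2}[x]gbasisE [X in gmul _ X]gbasisE gmul_sumr.
by apply: eq_bigr => A _; rewrite gmulZr gmulE wsign0l scale1r set0U.
Qed.

Lemma gmul1r : right_id (gbasis set0) gmul.
Proof.
move=> x; rewrite {2}[x]gbasisE [X in gmul X _]gbasisE gmul_suml.
by apply: eq_bigr => A _; rewrite gmulZl gmulE wsign0r scale1r setU0.
Qed.

Lemma gone_neq0 : gbasis set0 != 0.
Proof.
by apply/eqP => /ffunP/(_ set0); rewrite !ffunE eqxx => /eqP; rewrite oner_eq0.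
Qed.

HB.instance Definition _ := GRing.Zmodule_isNzRing.Build G
  gmulA gmul1l gmul1r gmulDl gmulDr gone_neq0.

Lemma gscaleAl (a : F) x y : a *: (x * y) = (a *: x) * y.
Proof. by rewrite -[RHS]/(gmul _ _) gmulZl. Qed.
HB.instance Definition _ := GRing.Lmodule_isLalgebra.Build F G gscaleAl.

Lemma gscaleAr (a : F) x y : a *: (x * y) = x * (a *: y).
Proof. by rewrite -[RHS]/(gmul _ _) gmulZr. Qed.
HB.instance Definition _ := GRing.Lalgebra_isAlgebra.Build F G gscaleAr.
HB.instance Definition _ := Algebra_isFalgebra.Build F G.

End Grassmann.

Section OrderedProduct.
Variables (F : fieldType) (m : nat) (B : algType F) (v : 'I_m -> B).
Implicit Types (S T : {set 'I_m}) (i j k : 'I_m).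

Local Notation P S := (\prod_(i in S) v i).

Lemma prod_min i S : i \in S -> {in S, forall j, (i <= j)%N} ->
  P S = v i * P (S :\ i).
Proof.
move=> iS imin.
have srt : sorted (fun a b : 'I_m => a < b)%N (index_enum 'I_m).
  rewrite /index_enum unlock -enumT.
  rewrite -[sorted _ _]/(sorted (relpre (val : 'I_m -> nat) ltn) _).
  rewrite -sorted_map val_enum_ord.
  exact: iota_ltn_sorted.
have tr : transitive (fun a b : 'I_m => a < b)%N.
  by move=> a b c; apply: ltn_trans.
rewrite -big_filter -[in RHS]big_filter.
suff -> : [seq k <- index_enum 'I_m | k \in S] =
    i :: [seq k <- index_enum 'I_m | k \in S :\ i] by rewrite big_cons.
apply: (irr_sorted_eq tr).
- by move=> a; apply: ltnn.
- exact: sorted_filter.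
- rewrite /= path_min_sorted; first exact: sorted_filter.
  apply/allP => k; rewrite mem_filter !inE => /andP[/andP[ki kS] _].
  by rewrite ltn_neqAle imin // andbT eq_sym.
- move=> k; rewrite in_cons !mem_filter !inE mem_index_enum !andbT.
  by case: eqP => [->|].
Qed.

Lemma ex_min S : S != finset.set0 ->
  {i | i \in S & {in S, forall j, (i <= j)%N}}.
Proof.
case/set0Pn/sigW => i0 i0S.
by case: (arg_minnP (fun i => nat_of_ord i) i0S) => i iS imin; exists i.
Qed.

Lemma wsign_min i S : {in S, forall j, (i < j)%N} -> wsign F [set i] S = 1.
Proof.
move=> imin; rewrite /wsign disjoints1; case: ifPn => [_|].
  rewrite /ninv big_set1 big1 // => j /imin lt_ij.
  by rewrite ltnNge ltnW.
by rewrite negbK => /imin; rewrite ltnn.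
Qed.

Hypothesis v2 : forall i, v i * v i = 0.
Hypothesis vA : forall i j, v i * v j = - (v j * v i).

Lemma mulv_prod i S : v i * P S = wsign F [set i] S *: P (i |: S).
Proof.
elim: {S}#|S| {-2}S (leqnn #|S|) => [|n IHn] S.
  rewrite leqn0 cards_eq0 => /eqP->.
  by rewrite wsign0r setU0 big_set0 big_set1 mulr1 scale1r.
have [->|/ex_min[j jS jmin] leS] := eqVneq S finset.set0.
  by rewrite wsign0r setU0 big_set0 big_set1 mulr1 scale1r.
have [iS|niS] := boolP (i \in S).
  rewrite /wsign disjoints1 iS scale0r.
  have [<-|ne_ij] := eqVneq j i.
    by rewrite (prod_min jS) // mulrA v2 mul0r.
  rewrite (prod_min jS) // mulrA vA mulNr -mulrA IHn; last first.
    by move: leS; rewrite (cardsD1 j) jS.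
  by rewrite /wsign disjoints1 !inE eq_sym ne_ij iS scale0r mulr0 oppr0.
have ne_ij : i != j by apply: contraNneq niS => ->.
have [lt_ij|] := ltnP i j.
  rewrite wsign_min; last by move=> k /jmin; apply: leq_trans.
  rewrite scale1r [RHS](@prod_min i) ?setU11 ?setU1K //.
  move=> k; rewrite !inE => /predU1P[->//|/jmin le_jk].
  exact: leq_trans (ltnW lt_ij) le_jk.
rewrite leq_eqVlt eq_sym (inj_eq val_inj) (negPf ne_ij) /= => lt_ji.
rewrite (prod_min jS) // mulrA vA mulNr -mulrA IHn; last first.
  by move: leS; rewrite (cardsD1 j) jS.
rewrite [P (i |: S)](@prod_min j); first last.
- move=> k; rewrite !inE => /predU1P[->|/jmin//]; exact: ltnW.
- by rewrite !inE jS orbT.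
have -> : (i |: S) :\ j = i |: (S :\ j).
  by apply/setP => k; rewrite !inE; case: (eqVneq k i) => // ->; rewrite ne_ij.
rewrite -scalerAr -scaleNr; congr (_ *: _).
rewrite /wsign !disjoints1 !inE (negPf niS) andbF /= /ninv !big_set1.
by rewrite [in RHS](big_setD1 j) //= lt_ji exprS mulN1r.
Qed.

Lemma prod_prod S T : P S * P T = wsign F S T *: P (S :|: T).
Proof.
elim: {S}#|S| {-2}S (leqnn #|S|) => [|n IHn] S.
  rewrite leqn0 cards_eq0 => /eqP->.
  by rewrite wsign0l set0U big_set0 mul1r scale1r.
have [->|/ex_min[j jS jmin] leS] := eqVneq S finset.set0.
  by rewrite wsign0l set0U big_set0 mul1r scale1r.
rewrite (prod_min jS) // -mulrA IHn; last first.
  by move: leS; rewrite (cardsD1 j) jS.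
rewrite -scalerAr mulv_prod scalerA setUA setD1K // -wsignA.
rewrite wsign_min ?mul1r ?setD1K // => k.
rewrite !inE => /andP[ne_kj /jmin].
by rewrite leq_eqVlt eq_sym (inj_eq val_inj) (negPf ne_kj).
Qed.
End OrderedProduct.

(* The exterior algebra of a finite-dimensional space, built on a basis;
   [exterior_universal] shows that the choice of basis is immaterial. *)
Definition exterior (F : fieldType) (U : vectType F) : Type :=
  grassmann F (\dim {:U}).

HB.instance Definition _ (F : fieldType) (U : vectType F) :=
  Falgebra.copy (exterior U) (grassmann F (\dim {:U})).

Section Exterior.
Variables (F : fieldType) (U : vectType F).
Local Notation m := (\dim {:U}).
Local Notation E := (exterior U).
Local Notation e := (vbasis {:U}).
Implicit Types (S : {set 'I_m}) (u : U) (x y : E).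

Definition eta u : E := \sum_(i < m) coord e i u *: (gbasis F [set i] : E).

Fact eta_linear : linear eta.
Proof.
move=> a u w; rewrite /eta scaler_sumr -big_split; apply: eq_bigr => i _ /=.
by rewrite linearP /= scalerDl scalerA.
Qed.
HB.instance Definition _ := GRing.isLinear.Build F U E _ eta eta_linear.

Lemma coord_vbasis_id (i j : 'I_m) : coord e i e`_j = (i == j)%:R.
Proof. by rewrite coord_free ?(basis_free (vbasisP _)) // eq_sym. Qed.

Lemma eta_vbasis (i : 'I_m) : eta e`_i = gbasis F [set i].
Proof.
rewrite /eta (bigD1 i) //= coord_vbasis_id eqxx scale1r big1 ?addr0 // => j ne.
by rewrite coord_vbasis_id (negPf ne) scale0r.
Qed.

Lemma gbasis_mul (A B : {set 'I_m}) :
  (gbasis F A : E) * (gbasis F B : E) =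
  wsign F A B *: (gbasis F (A :|: B) : E).
Proof. exact: gmulE. Qed.

Lemma gbasis1_anti (i j : 'I_m) :
  (gbasis F [set i] : E) * (gbasis F [set j] : E) =
  - ((gbasis F [set j] : E) * (gbasis F [set i] : E)).
Proof.
rewrite !gbasis_mul finset.setUC -scaleNr; congr (_ *: _).
rewrite /wsign !disjoints1 !inE eq_sym /ninv !big_set1.
by case: ltngtP => [_|_|/val_inj->]; rewrite ?eqxx ?oppr0 //;
   case: eqVneq => _ /=; rewrite ?oppr0 ?expr0 ?expr1 ?opprK.
Qed.

Lemma gbasis1_sq (i : 'I_m) : (gbasis F [set i] : E) * (gbasis F [set i] : E) = 0.
Proof. by rewrite gbasis_mul /wsign disjoints1 !inE eqxx scale0r. Qed.

Lemma eta_sq u : eta u * eta u = 0.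
Proof.
have H n (s : 'I_n -> E) : (forall i, s i * s i = 0) ->
    (forall i j, s i * s j = - (s j * s i)) ->
    (\sum_i s i) * (\sum_i s i) = 0.
  elim: n s => [|n IHn] s s2 sA; first by rewrite big_ord0 mul0r.
  rewrite big_ord_recl mulrDl !mulrDr s2 add0r IHn ?addr0 //.
  rewrite mulr_suml mulr_sumr -big_split big1 // => i _ /=.
  by rewrite sA addNr.
apply: H => [i|i j].
  by rewrite -scalerAl -scalerAr gbasis1_sq !scaler0.
rewrite -!scalerAl -!scalerAr gbasis1_anti !scalerN !scalerA.
by rewrite [X in X *: _]mulrC.
Qed.

Lemma eta_anti u w : eta u * eta w = - (eta w * eta u).
Proof.
have := eta_sq (u + w).
rewrite linearD mulrDl !mulrDr !eta_sq add0r addr0 => /eqP.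
by rewrite addr_eq0 => /eqP.
Qed.

Lemma prod_eta_vbasis S : \prod_(i in S) eta e`_i = gbasis F S.
Proof.
under eq_bigr do rewrite eta_vbasis.
elim: {S}#|S| {-2}S (leqnn #|S|) => [|n IHn] S.
  by rewrite leqn0 cards_eq0 => /eqP->; rewrite big_set0.
have [->|/ex_min[j jS jmin] leS] := eqVneq S finset.set0.
  by rewrite big_set0.
rewrite (prod_min _ jS) // IHn; last by move: leS; rewrite (cardsD1 j) jS.
rewrite gbasis_mul wsign_min ?scale1r ?setD1K // => k.
rewrite !inE => /andP[ne_kj /jmin].
by rewrite leq_eqVlt eq_sym (inj_eq val_inj) (negPf ne_kj).
Qed.

Section Lift.
Variables (B : algType F) (h : U -> B).

(* The algebra morphism extending h : U -> B, when h is linear and squares to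
   zero. *)
Definition elift x : B := \sum_S (x S : F) *: \prod_(i in S) h e`_i.

Fact elift_linear : linear elift.
Proof.
move=> a x y; rewrite /elift scaler_sumr -big_split; apply: eq_bigr => S _ /=.
by rewrite !ffunE scalerDl scalerA.
Qed.
HB.instance Definition _ := GRing.isLinear.Build F E B _ elift elift_linear.

Lemma elift_gbasis S : elift (gbasis F S) = \prod_(i in S) h e`_i.
Proof.
rewrite /elift (bigD1 S) //= [X in _ + X]big1 ?addr0 => [|T ne].
  by rewrite ffunE eqxx scale1r.
by rewrite ffunE (negPf ne) scale0r.
Qed.
End Lift.

Theorem exterior_universal (B : algType F) (h : {linear U -> B}) :
    (forall u, h u * h u = 0) ->
  [/\ forall u, elift h (eta u) = h u, elift h 1 = 1,
      {morph elift h : x y / x * y}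
    & forall phi : {lrmorphism E -> B},
        (forall u, phi (eta u) = h u) -> phi =1 elift h].
Proof.
move=> h2; have hA u w : h u * h w = - (h w * h u).
  have := h2 (u + w); rewrite linearD mulrDl !mulrDr !h2 add0r addr0 => /eqP.
  by rewrite addr_eq0 => /eqP.
split.
- move=> u; rewrite /eta linear_sum {2}(coord_vbasis (memvf u)) linear_sum.
  apply: eq_bigr => i _; rewrite !linearZ /=; congr (_ *: _).
  by rewrite elift_gbasis big_set1.
- by rewrite -[1]/(gbasis F finset.set0) elift_gbasis big_set0.
- move=> x y; rewrite [elift h x]/elift [elift h y]/elift.
  rewrite {1}[x]gbasisE {1}[y]gbasisE.
  rewrite !mulr_suml linear_sum; apply: eq_bigr => S _.
  rewrite !mulr_sumr linear_sum; apply: eq_bigr => T _.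
  rewrite -!scalerAl -!scalerAr !linearZ /= [RHS]scalerA mulrC -scalerA.
  congr (_ *: (_ *: _)); rewrite gbasis_mul linearZ /= !elift_gbasis.
  by rewrite (prod_prod (v := fun i : 'I_m => h e`_i)).
- move=> phi phi_eta x; rewrite {1}[x]gbasisE linear_sum; apply: eq_bigr => S _.
  rewrite linearZ /= -prod_eta_vbasis rmorph_prod; congr (_ *: _).
  by apply: eq_bigr => i _; rewrite /= phi_eta.
Qed.

(* The d-th exterior power, as the span of the d-fold products of vectors. *)
Definition extpow d : {vspace E} := (limg (linfun eta) ^+ d)%VS.

Lemma eta_limg u : eta u \in limg (linfun eta).
Proof. by rewrite -(lfunE eta) memv_img ?memvf. Qed.

Lemma prod_eta_extpow (f : 'I_m -> U) S :
  \prod_(i in S) eta (f i) \in extpow #|S|.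
Proof.
rewrite -sum1_card -big_filter -[X in extpow X]big_filter.
elim: [seq i <- index_enum _ | i \in S] => [|i s IHs]; first by rewrite !big_nil /extpow expv0 memv_line.
by rewrite !big_cons /= /extpow expvSl memv_mul ?eta_limg.
Qed.

Lemma extpowE d : extpow d = (\sum_(S : {set 'I_m} | #|S| == d) <[gbasis F S : E]>)%VS.
Proof.
apply/eqP; rewrite eqEsubv; apply/andP; split; last first.
  apply/subv_sumP => S /eqP <-.
  by rewrite -memvE -prod_eta_vbasis prod_eta_extpow.
elim: d => [|d IHd].
  rewrite /extpow expv0 -[1%VS]/(<[1]>)%VS -[1]/(gbasis F finset.set0).
  by rewrite (sumv_sup finset.set0) ?cards0.
rewrite /extpow expvSl; apply/prodvP => u x /memv_imgP[w _ ->].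
rewrite lfunE => /(subvP IHd)/memv_sumP[f fP ->].
rewrite /eta mulr_suml memv_suml // => i _.
rewrite mulr_sumr memv_suml // => S Sd.
have /vlineP[a ->] := fP S Sd.
rewrite -scalerAl -scalerAr !memvZ // gbasis_mul /wsign disjoints1.
case: ifPn => iS; last by rewrite scale0r mem0v.
apply/memvZ/(subvP (sumv_sup (i |: S) _ (subvv _))); last exact: memv_line.
by rewrite cardsU1 iS (eqP Sd).
Qed.

Lemma extpow_gt d : (m < d)%N -> extpow d = 0%VS.
Proof.
move=> lt_md; rewrite extpowE big1 // => S /eqP Sd.
have := max_card (mem S); rewrite card_ord Sd leqNgt lt_md //.
Qed.

End Exterior.

Section Functor.
Variables (F : fieldType) (U V : vectType F) (f : 'Hom(U, V)).

(* The algebra morphism induced by f. *)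
Definition extmap : 'Hom(exterior U, exterior V) :=
  linfun (elift (@eta F V \o f)).

Lemma extmap_morph :
  [/\ forall u, extmap (eta u) = eta (f u), extmap 1 = 1
    & {morph extmap : x y / x * y}].
Proof.
have [h1 h2 h3 _] :=
  exterior_universal (h := @eta F V \o f) (fun u => eta_sq (f u)).
by split=> [u||x y]; rewrite !lfunE /= ?h1 ?h2 ?h3.
Qed.

Lemma extmap_extpow d x : x \in extpow U d -> extmap x \in extpow V d.
Proof.
have [h1 h0 h2] := extmap_morph; elim: d x => [|d IHd] x.
  rewrite /extpow !expv0 => /vlineP[a ->].
  by rewrite linearZ /= [X in _ *: X]h0 memvZ ?memv_line.
suff : (extpow U d.+1 <= extmap @^-1: extpow V d.+1)%VS.
  by move/subvP=> H /H; rewrite -memv_preim.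
rewrite {1}/extpow expvSl; apply/prodvP => y z /memv_imgP[w _ ->] zP.
rewrite -memv_preim h2 [linfun _ w]lfunE /= h1 /extpow expvSl memv_mul ?eta_limg //.
exact: IHd.
Qed.

(* The map induced on d-th exterior powers. *)
Definition extpow_map d : 'Hom(subvs_of (extpow U d), subvs_of (extpow V d)) :=
  linfun (vsproj (extpow V d) \o extmap \o vsval).

Lemma extpow_mapE d x : vsval (extpow_map d x) = extmap (vsval x).
Proof. by rewrite lfunE /= vsprojK // extmap_extpow ?subvsP. Qed.

End Functor.

Section Invariants.
Variables (F : fieldType) (W : vectType F) (T : Type).
Variables (act : T -> 'End(W)) (G : set T).

Definition invariants : {vspace W} :=
  xget 0%VS [set X : {vspace W} |
    forall x, x \in X <-> forall g, G g -> act g x = x]%classic.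

Lemma invariantsP x : x \in invariants <-> forall g, G g -> act g x = x.
Proof.
suff /(xgetPex 0%VS) : exists X : {vspace W},
    forall x, x \in X <-> forall g, G g -> act g x = x by apply.
pose fixd (X : {vspace W}) := forall x, x \in X -> forall g, G g -> act g x = x.
pose p d := `[< exists2 X : {vspace W}, fixd X & \dim X = d >].
have p0 : exists d, p d.
  exists 0%N; apply/asboolP; exists 0%VS; last by rewrite dimv0.
  by move=> y; rewrite memv0 => /eqP-> g _; rewrite linear0.
have pmax d : p d -> (d <= \dim {:W})%N.
  by move=> /asboolP[X _ <-]; rewrite dimvS ?subvf.
case: (ex_maxnP p0 pmax) => d /asboolP[X fX dX] dmax; exists X => y.
split=> [/fX//|fy]; rewrite memvE.
have le : (\dim (X + <[y]>) <= \dim X)%N.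
  rewrite dX; apply: dmax; apply/asboolP; exists (X + <[y]>)%VS => // z.
  case/memv_addP=> a aX [b /vlineP[c ->] ->] g Gg.
  by rewrite linearD linearZ /= fX // fy.
have /eqP -> : X == (X + <[y]>)%VS by rewrite eqEdim addvSl le.
exact: addvSr.
Qed.

End Invariants.

(* The Hilbert series of the invariants of the exterior algebra of U; it is a
   polynomial since the d-th exterior power vanishes for d > dim U. *)
Definition hilbert_ext_inv (F : fieldType) (U : vectType F) (T : Type)
    (act : T -> 'End(U)) (G : set T) : {poly int} :=
  \poly_(d < (\dim {:U}).+1)
    (\dim (extpow U d :&: invariants (fun g => extmap (act g)) G))%:R.

Lemma coef_hilbert_ext_inv (F : fieldType) (U : vectType F) (T : Type)
    (act : T -> 'End(U)) (G : set T) (d : nat) :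
  (hilbert_ext_inv act G)`_d =
  (\dim (extpow U d :&: invariants (fun g => extmap (act g)) G))%:R.
Proof.
rewrite coef_poly; case: ltnP => // lt_md.
by rewrite extpow_gt // cap0v dimv0.
Qed.

Definition std_act (F : fieldType) (n : nat) (g : 'M[F]_n) : 'End('cV[F]_n) :=
  linfun (mulmx g).

Definition ext2_act (F : fieldType) (n : nat) (g : 'M[F]_n) :
    'End(subvs_of (extpow 'cV[F]_n 2)) :=
  extpow_map (std_act g) 2.

Definition symplectic_form (F : fieldType) (k : nat) : 'M[F]_(k + k) :=
  block_mx 0 1%:M (- 1%:M) 0.

Definition Sp (F : fieldType) (k : nat) : set 'M[F]_(k + k) :=
  [set g | g \in unitmx /\
           g^T *m symplectic_form F k *m g = symplectic_form F k]%classic.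
Arguments Sp F k : clear implicits.

(* Main.v *)
From HB Require Import structures.
Require Import Defs.
From mathcomp Require Import reals complex.
From mathcomp Require Import all_boot all_order all_algebra all_field.
From mathcomp Require Import perm ring zify.

Set Implicit Arguments.
Unset Strict Implicit.
Unset Printing Implicit Defensive.
Import Order.TTheory GRing.Theory Num.Theory.
Local Open Scope ring_scope.

(** Put V = C^n with n = 2k and U = Lambda^2 V. As a representation of Sp(2k),
    U is the quotient of gl(2k) by sp(2k), and the invariants of its exterior
    algebra are the cohomology of U(2k)/Sp(k): an exterior algebra on
    generators of degrees 1, 5, ..., 4k - 3. The Hilbert series is therefore
    the product of the 1 + t^(4i+1) for i < k ([hilbert_Sp]), and the double
    sum of the statement is the expansion of this product by the q-binomial
    theorem at q = t^4 ([hilbert_identity]).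

    The generators are traces. Let X be the skew matrix whose entries are the
    anticommuting elements e_a /\ e_b, and J the symplectic form. The trace of
    (JX)^m is invariant, and vanishes unless m = 1 mod 4: cyclicity kills the
    even m, transposition those congruent to 2 or 3. It also vanishes for
    m > 2n by the Amitsur-Levitzki theorem ([wtrace_large]), proved in Rosset's
    way: the entries of (JX)^2 lie in a commutative ring, and its powers have
    trace zero, so that it is nilpotent by Newton's identities
    ([nilpotent_of_traces]).

    That these traces generate comes from the first fundamental theorem
    ([symplectic_fft]): the invariant tensors of Sp are spanned by the products
    of values of J over the perfect matchings of the slots. The argument is by
    induction on the number of slots. The Casimir element of sp(n) kills an
    invariant tensor; written in terms of slots, it is the sum of
    (n + 1) * (number of slots), of the transpositions of two slots, and of
    contractions with J of two slots, which are matchings by induction. The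
    first two summands together form the Casimir element of gl(n), a sum of
    squares, plus the number of slots: they are positive definite, hence
    invertible, and preserve the span of the matchings ([casimir_matchings]).
    An invariant of the exterior algebra is lifted to an invariant tensor by
    iterated interior products ([iter_iprod_euler]), and a matching, evaluated
    on the entries of X, becomes a product of traces ([matchings_chains]).

    It remains to see that the 2^k products of distinct generators are
    independent. The top exterior power of U is semi-invariant under the
    transvections, which is all that the first fundamental theorem uses of Sp,
    so it is spanned by products of generators; for reasons of degree the full
    product is the only candidate, and it is nonzero ([monoT_neq0]).
    Multiplication by complementary products then separates the others
    ([dim_trace_alg]). *)

(** * Preliminaries on polynomials and skew forms *)

Lemma deriv_sum (R : nzSemiRingType) (T : Type) (r : seq T) (F : T -> {poly R}) :
  (\sum_(i <- r) F i)^`() = \sum_(i <- r) (F i)^`().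
Proof. by elim: r => [|i r IHr]; rewrite ?big_nil ?deriv0 ?big_cons // derivD IHr. Qed.

Lemma deriv_prod (R : comNzSemiRingType) (T : finType) (A : {set T})
    (F : T -> {poly R}) :
  (\prod_(i in A) F i)^`() =
  \sum_(i in A) (F i)^`() * \prod_(j in A :\ i) F j.
Proof.
elim: {A}#|A| {-2}A (erefl #|A|) => [|m IHm] A cA.
  by have -> : A = set0 by [apply/eqP; rewrite -cards_eq0 cA]; rewrite !big_set0 derivC.
have /set0Pn[a aA] : A != set0 by rewrite -cards_eq0 cA.
rewrite (big_setD1 a) //= derivM (big_setD1 a (A := A)) //=; congr (_ + _).
rewrite IHm; last by move: cA; rewrite (cardsD1 a) aA => -[].
rewrite mulr_sumr; apply: eq_bigr => b; rewrite !inE => /andP[ne bA].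
rewrite [in RHS](big_setD1 a) /= ?inE 1?eq_sym ?ne // mulrCA; congr (_ * (_ * _)).
by apply: eq_bigl => c; rewrite !inE andbCA.
Qed.

Lemma poly_ext (R : numDomainType) (p q : {poly R}) :
  (forall t, p.[t] = q.[t]) -> p = q.
Proof.
move=> e; apply/eqP; rewrite -subr_eq0; apply/negPn/negP => nz.
pose s := [seq i%:R : R | i <- iota 0 (size (p - q))].
have us : uniq s by rewrite map_inj_uniq ?iota_uniq // => i j /eqP; rewrite eqr_nat => /eqP.
have rs : all (root (p - q)) s.
  by apply/allP => x _; rewrite /root !hornerE e subrr.
by have := max_poly_roots nz rs us; rewrite size_map size_iota ltnn.
Qed.

Lemma skew_form_self (R : numDomainType) n (J : 'M[R]_n) (u : 'cV[R]_n) :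
  J^T = - J -> u^T *m J *m u = 0.
Proof.
move=> JT; apply/matrixP => a b; rewrite !ord1 [RHS]mxE; apply/eqP.
have zT : (u^T *m J *m u)^T = - (u^T *m J *m u).
  by rewrite !trmx_mul trmxK JT mulNmx mulmxN mulmxA.
have /matrixP/(_ 0 0)/eqP := zT; rewrite !mxE -addr_eq0 -mulr2n.
by rewrite mulrn_eq0.
Qed.

(** * Tensors and the first fundamental theorem for the symplectic group *)

Section Tensors.
Variables (C : numClosedFieldType) (n : nat) (P : finType).
Local Notation I := 'I_n.
Local Notation Idx := {ffun P -> 'I_n}.
Local Notation Tens := {ffun Idx -> C^o}.
Implicit Types (i j : Idx) (p q r : P) (S : {set P}) (f : Idx -> C).
Implicit Types (X : 'M[C]_n) (a b c : I).

Definition upd i p a : Idx := [ffun q => if q == p then a else i q].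
Definition rename i (s : {perm P}) : Idx := [ffun q => i (s q)].

Lemma upd_id i p : upd i p (i p) = i.
Proof. by apply/ffunP => q; rewrite ffunE; case: eqP => // ->. Qed.

Lemma upd_upd i p a b : upd (upd i p a) p b = upd i p b.
Proof. by apply/ffunP => q; rewrite !ffunE; case: eqP. Qed.

Lemma updC i p q a b : p != q -> upd (upd i p a) q b = upd (upd i q b) p a.
Proof.
move=> ne; apply/ffunP => r; rewrite !ffunE.
by case: eqP => // ->; rewrite eq_sym (negPf ne).
Qed.

Lemma updE i p a : upd i p a p = a.
Proof. by rewrite ffunE eqxx. Qed.

Lemma updN i p q a : q != p -> upd i p a q = i q.
Proof. by rewrite ffunE => /negPf->. Qed.

Lemma rename_tperm i p q :
  rename i (tperm p q) = upd (upd i p (i q)) q (i p).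
Proof.
apply/ffunP => r; rewrite !ffunE.
case: tpermP => [->|->|/eqP/negPf-> /eqP/negPf->//]; last by rewrite eqxx.
by rewrite eqxx; case: eqP => // ->.
Qed.

(** A tensor is a function of indices, one index for each slot in [P]; all
    operations are relative to a set [S] of slots, so that contracting two slots
    needs no renumbering. [lie_act] is the action of gl(n) on the slots in [S]. *)
Definition lie_act X S f i : C := \sum_(p in S) \sum_c X (i p) c * f (upd i p c).

Lemma lieD X Y S f i : lie_act (X + Y) S f i = lie_act X S f i + lie_act Y S f i.
Proof.
rewrite /lie_act -big_split; apply: eq_bigr => p _ /=.
by rewrite -big_split; apply: eq_bigr => c _ /=; rewrite mxE mulrDl.
Qed.

Lemma lieN X S f i : lie_act (- X) S f i = - lie_act X S f i.
Proof.
rewrite /lie_act -sumrN; apply: eq_bigr => p _ /=.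
by rewrite -sumrN; apply: eq_bigr => c _ /=; rewrite mxE mulNr.
Qed.

Definition depends S f := forall i j, {in S, i =1 j} -> f i = f j.

Variable J : 'M[C]_n.
Hypotheses (JT : J^T = - J) (JJ : J *m J = - 1%:M).

(** Invariance under the rank-one elements u u^T J, the derivatives of the
    symplectic transvections. They span sp(n). *)
Definition lie_inv S f := forall (u : 'cV[C]_n) i, lie_act (u *m u^T *m J) S f i = 0.

Definition contr p q f i : C := \sum_b \sum_c J b c * f (upd (upd i p b) q c).

Lemma JE a b : J b a = - J a b.
Proof. by have /matrixP/(_ a b) := JT; rewrite !mxE. Qed.

Lemma JJE a c : \sum_b J b a * J b c = (a == c)%:R.
Proof.
have /matrixP/(_ a c) : J^T *m J = 1%:M by rewrite JT mulNmx JJ opprK.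
by rewrite !mxE => <-; apply: eq_bigr => b _; rewrite !mxE.
Qed.

(** The elements E_ba + J E_ab J of sp(n) are polarizations of the u u^T J, at
    the vectors e_b and J e_a. *)
Lemma inv_polar S f a b i : lie_inv S f ->
  lie_act (delta_mx b a + J *m delta_mx a b *m J) S f i = 0.
Proof.
move=> If; pose e x : 'cV[C]_n := delta_mx x 0; pose w := J *m e a.
have ee x y : e x *m (e y)^T = delta_mx x y.
  by rewrite /e trmx_delta mul_delta_mx.
have -> : delta_mx b a + J *m delta_mx a b *m J =
    (e b + w) *m (e b + w)^T *m J - e b *m (e b)^T *m J - w *m w^T *m J.
  have E1 : delta_mx b a = e b *m w^T *m J.
    by rewrite /w trmx_mul JT -!mulmxA mulNmx JJ opprK mulmx1 ee.
  have E2 : w *m (e b)^T *m J = J *m delta_mx a b *m J.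
    by rewrite /w -(mulmxA J (e a)) ee.
  rewrite E1 -E2 {E1 E2}.
  rewrite ![(_ + _)^T]linearD /= !(mulmxDl, mulmxDr).
  move: (_ *m _ *m J) (_ *m _ *m J) (_ *m _ *m J) (_ *m _ *m J) => A B D E.
  by apply/matrixP => x y; rewrite !mxE; ring.
by rewrite !(lieD, lieN) !If !subr0.
Qed.

(** The vanishing of the Casimir element of sp(n) on an invariant, one slot at a
    time: apply E_ba + J E_ab J with a = i p to the tensor at the index [i] with
    [b] put in the slot [p], and sum over [b]. The slot [p] itself contributes
    n + 1, any other slot a transposition and a contraction. *)
Lemma casimir_slot S f i p : lie_inv S f -> p \in S ->
  n.+1%:R * f i + \sum_(q in S | q != p)
    (f (rename i (tperm p q)) - J (i p) (i q) * contr p q f i) = 0.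
Proof.
move=> If pS; set a := i p.
transitivity (\sum_b lie_act (delta_mx b a + J *m delta_mx a b *m J) S f (upd i p b));
  last by apply: big1 => b _; apply: inv_polar.
have XE b x y : (delta_mx b a + J *m delta_mx a b *m J) x y =
    (x == b)%:R * (y == a)%:R + J x a * J b y.
  rewrite !mxE -mulnb natrM; congr (_ + _).
  rewrite (bigD1 b) //= mxE (bigD1 a) //= !mxE !eqxx mulr1.
  rewrite !big1 ?addr0 // => z ne.
    rewrite mxE (bigD1 a) //= !mxE (negPf ne) eqxx mulr0 add0r.
    by rewrite big1 ?mul0r // => t net; rewrite mxE (negPf ne) andbF mulr0.
  by rewrite mxE (negPf ne) mulr0.
rewrite /lie_act exchange_big /= [RHS](bigD1 p) //=; congr (_ + _).
  under eq_bigr do under eq_bigr do rewrite XE updE upd_upd eqxx mul1r.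
  under eq_bigr do under eq_bigr do rewrite mulrDl.
  under eq_bigr do rewrite big_split /=.
  rewrite big_split /= mulrSr mulrDl mul1r. congr (_ + _).
    under eq_bigr => b _.
      rewrite (bigD1 a) //= eqxx mul1r big1 ?addr0; last first.
        by move=> c /negPf->; rewrite mul0r.
      rewrite upd_id; over.
    by rewrite sumr_const card_ord mulr_natl.
  rewrite exchange_big /= (bigD1 a) //= -mulr_suml JJE eqxx mul1r upd_id.
  by rewrite big1 ?addr0 // => c ne; rewrite -mulr_suml JJE eq_sym (negPf ne) mul0r.
apply: eq_bigr => q /andP[qS ne].
under [RHS]eq_bigr do under eq_bigr do rewrite XE updN // mulrDl.
under [RHS]eq_bigr do rewrite big_split /=.
rewrite big_split /=; congr (_ + _).
  rewrite rename_tperm (bigD1 (i q)) //= (bigD1 a) //= !eqxx !mul1r.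
  rewrite !big1 ?addr0 // => [b nb|c nc].
    by apply: big1 => c _; rewrite eq_sym (negPf nb) !mul0r.
  by rewrite (negPf nc) mulr0 mul0r.
rewrite JE mulNr opprK /contr mulr_sumr; apply: eq_bigr => b _.
by rewrite mulr_sumr; apply: eq_bigr => c _; rewrite mulrA.
Qed.



Lemma sum_upd (V : zmodType) (F : Idx -> V) p :
  \sum_(i : Idx) \sum_b F (upd i p b) = (\sum_i F i) *+ n.
Proof.
rewrite pair_bigA /=.
pose h (x : Idx * I) := (upd x.1 p x.2, x.1 p).
have hK : involutive h.
  by case=> i b; rewrite /h /= updE upd_upd upd_id.
rewrite (reindex_inj (inv_inj hK)) /=.
under eq_bigr do rewrite upd_upd upd_id.
rewrite -(pair_bigA _ (fun i _ => F i)) /=.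
by under eq_bigr do rewrite sumr_const card_ord; rewrite -sumrMnl.
Qed.

(** The actions of E_ab in two different slots, paired with each other and
    summed over [a] and [b], amount to the transposition of the two slots. *)
Lemma sum_diag_upd (F : Idx -> Idx -> C) p q : p != q ->
  \sum_(i : Idx) \sum_b (i p == i q)%:R * F (upd i p b) (upd i q b) =
  \sum_i F (rename i (tperm p q)) i.
Proof.
move=> ne; rewrite pair_bigA /=.
rewrite (bigID (fun x : Idx * I => x.1 p == x.1 q)) /= [X in _ + X]big1 ?addr0; last first.
  by move=> x /negPf->; rewrite mul0r.
rewrite (reindex_onto (fun j : Idx => (upd j q (j p), j q))
                      (fun x : Idx * I => upd x.1 q x.2)) /=; last first.
  case=> i b /= /eqP e; congr pair; last exact: updE.
  by rewrite upd_upd updN // e upd_id.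
apply: eq_big => [j|j _]; first by rewrite updN // updE eqxx upd_upd upd_id eqxx.
rewrite updN // updE eqxx mul1r upd_upd upd_id; congr (F _ _).
by rewrite rename_tperm [in RHS]updC.
Qed.

(** The Casimir element of sp(n) without its contraction terms. It exceeds the
    Casimir element of gl(n), which is a sum of squares, by a positive scalar. *)
Definition casimir S f i : C :=
  (n.+1 * #|S|)%:R * f i +
  \sum_(p in S) \sum_(q in S | q != p) f (rename i (tperm p q)).

(** With G a b the action of E_ab, the hermitian form of [casimir] at [f] is
    the number of slots times |f|^2 plus the sum of the |G a b f|^2. *)
Lemma casimir_pos S f : (0 < #|S|)%N -> (forall i, casimir S f i = 0) ->
  forall i, f i = 0.
Proof.
move=> S0 f0.
pose N := \sum_i f i * (f i)^*.
pose G a b i := \sum_(p in S) (i p == a)%:R * f (upd i p b).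
have N_ge0 : 0 <= N by apply: sumr_ge0 => i _; apply: mul_conjC_ge0.
suff e : \sum_i casimir S f i * (f i)^* =
    #|S|%:R * N + \sum_a \sum_b \sum_i G a b i * (G a b i)^*.
  have : #|S|%:R * N + \sum_a \sum_b \sum_i G a b i * (G a b i)^* = 0.
    by rewrite -e big1 // => i _; rewrite f0 mul0r.
  move/eqP; rewrite paddr_eq0; last 2 first.
  - by rewrite mulr_ge0 ?ler0n.
  - apply: sumr_ge0 => a _; apply: sumr_ge0 => b _; apply: sumr_ge0 => i _.
    exact: mul_conjC_ge0.
  rewrite mulf_eq0 pnatr_eq0 -leqn0 leqNgt S0 /= => /andP[/eqP N0 _] i.
  have /eqP := psumr_eq0P (fun j _ => mul_conjC_ge0 (f j)) N0 isT (i := i).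
  by rewrite mul_conjC_eq0 => /eqP.
have -> : \sum_a \sum_b \sum_i G a b i * (G a b i)^* =
  \sum_(p in S) \sum_(q in S) \sum_(i : Idx) \sum_b (i p == i q)%:R *
     (f (upd i p b) * (f (upd i q b))^*).
  transitivity (\sum_(p in S) \sum_(q in S) \sum_a \sum_b \sum_(i : Idx)
     (i p == a)%:R * f (upd i p b) * ((i q == a)%:R * (f (upd i q b))^*)).
    under [RHS]eq_bigr do rewrite exchange_big.
    rewrite [RHS]exchange_big; apply: eq_bigr => a _ /=.
    under [RHS]eq_bigr do rewrite exchange_big.
    rewrite [RHS]exchange_big; apply: eq_bigr => b _ /=.
    under [RHS]eq_bigr do rewrite exchange_big.
    rewrite [RHS]exchange_big; apply: eq_bigr => i _ /=.
    rewrite /G rmorph_sum mulr_suml; apply: eq_bigr => p _.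
    by rewrite mulr_sumr; apply: eq_bigr => q _; rewrite rmorphM /= conjC_nat.
  apply: eq_bigr => p _; apply: eq_bigr => q _.
  under eq_bigr do rewrite exchange_big /=.
  rewrite exchange_big; apply: eq_bigr => i _ /=.
  rewrite exchange_big; apply: eq_bigr => b _ /=.
  rewrite (bigD1 (i p)) //= eqxx mul1r big1 ?addr0 => [|a ne].
    by rewrite eq_sym mulrCA.
  by rewrite eq_sym (negPf ne) !mul0r.
under eq_bigr do rewrite mulrDl.
rewrite big_split /=.
under eq_bigr do rewrite -mulrA.
rewrite -mulr_sumr -/N mulnC mulnS natrD mulrDl -addrA; congr (_ + _).
under [X in _ + X = _]eq_bigr do rewrite mulr_suml.
rewrite exchange_big /= natrM mulr_natl mulrnAl -sumr_const -big_split /=.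
apply: eq_bigr => p pS; rewrite [RHS](bigD1 p) //=; congr (_ + _).
  under [RHS]eq_bigr do under eq_bigr do rewrite eqxx mul1r.
  by rewrite (sum_upd (fun i => f i * (f i)^*)) mulr_natl.
under eq_bigr do rewrite mulr_suml.
rewrite exchange_big; apply: eq_bigr => q /andP[_ ne] /=.
by rewrite (@sum_diag_upd (fun i j => f i * (f j)^*)) // eq_sym.
Qed.


(** A common shape for the linear operators below: substitute, then multiply by
    a weight. *)
Definition wsub (w : Idx -> C) (h : Idx -> Idx) (f : Tens) : Tens :=
  [ffun i => w i * f (h i)].

Fact wsub_linear w h : linear (wsub w h).
Proof.
move=> a f g; apply/ffunP => i; rewrite !ffunE.
by rewrite mulrDr /GRing.scale /= mulrCA.
Qed.
HB.instance Definition _ w h :=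
  GRing.isLinear.Build C Tens Tens _ (wsub w h) (wsub_linear w h).

Definition mulJ p q : 'End(Tens) :=
  linfun (wsub (fun i => J (i p) (i q)) id).
Definition ren (s : {perm P}) : 'End(Tens) :=
  linfun (wsub (fun=> 1) (fun i => rename i s)).

Lemma mulJE p q (f : Tens) i : mulJ p q f i = J (i p) (i q) * f i.
Proof. by rewrite lfunE /= ffunE. Qed.

Lemma renE s (f : Tens) i : ren s f i = f (rename i s).
Proof. by rewrite lfunE /= ffunE mul1r. Qed.

Definition tens1 : Tens := [ffun=> 1].

(** The span of the products of [m] factors [J (i p) (i q)] over the perfect
    matchings of [S]. This reading is meant for [S] of size [2 * m]; a matching
    is built by choosing one pair at a time, so each of them occurs many times in
    the sum. *)
Fixpoint matchings m S : {vspace Tens} :=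
  if m is m'.+1 then
    (\sum_(p in S) \sum_(q in S | q != p)
       (mulJ p q @: matchings m' (S :\ p :\ q)))%VS
  else <[tens1]>%VS.

Lemma matchings_mul m S p q (f : Tens) : p \in S -> q \in S -> q != p ->
  f \in matchings m (S :\ p :\ q) -> mulJ p q f \in matchings m.+1 S.
Proof.
move=> pS qS ne fG /=.
apply: (subvP (sumv_sup p pS (sumv_sup q _ (subvv _)))); rewrite ?qS //.
exact: memv_img.
Qed.

Lemma matchings_ind m S (Q : Tens -> Prop) :
  Q 0 -> (forall f g : Tens, Q f -> Q g -> Q (f + g)) ->
  (forall p q (f : Tens), p \in S -> q \in S -> q != p ->
     f \in matchings m (S :\ p :\ q) -> Q (mulJ p q f)) ->
  forall f : Tens, f \in matchings m.+1 S -> Q f.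
Proof.
move=> Q0 QD Qm f /memv_sumP[F FP ->].
apply: big_ind => // p pS; have /memv_sumP[G GP ->] := FP p pS.
apply: big_ind => // q qS; have /memv_imgP[g gG ->] := GP q qS.
by case/andP: qS => qS ne; apply: Qm.
Qed.

Lemma matchings_depends m S (f : Tens) : f \in matchings m S -> depends S f.
Proof.
elim: m S f => [|m IHm] S.
  by move=> f /vlineP[c ->] i j _; rewrite !ffunE.
apply: matchings_ind => [i j _|f g Df Dg i j e|p q f pS qS ne fG i j e].
- by rewrite !ffunE.
- by rewrite !ffunE (Df i j e) (Dg i j e).
rewrite !mulJE (e p) // (e q) //; congr (_ * _).
by apply: IHm fG _ _ _ => r; rewrite !inE => /and3P[_ _]; apply: e.
Qed.

Lemma matchings_ren m S s (f : Tens) :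
  f \in matchings m S -> ren s f \in matchings m (s @: S).
Proof.
elim: m S f => [|m IHm] S.
  move=> f /vlineP[c ->]; rewrite linearZ memvZ //=.
  suff -> : ren s tens1 = tens1 by apply: memv_line.
  by apply/ffunP => i; rewrite renE !ffunE.
apply: matchings_ind => [|f g|p q f pS qS ne fG].
- by rewrite linear0 mem0v.
- by rewrite linearD; apply: memvD.
have -> : ren s (mulJ p q f) = mulJ (s p) (s q) (ren s f).
  by apply/ffunP => i; rewrite renE !mulJE renE !ffunE.
apply: matchings_mul; rewrite ?(inj_eq perm_inj) ?imset_f //.
have -> : s @: S :\ s p :\ s q = s @: (S :\ p :\ q); last exact: IHm.
apply/setP => r; rewrite -[r](permKV s) !inE !(mem_imset _ _ perm_inj).
by rewrite !inE !(inj_eq perm_inj).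
Qed.

Definition casimirL S : 'End(Tens) :=
  (n.+1 * #|S|)%:R *: \1%VF +
  \sum_(p in S) \sum_(q in S | q != p) ren (tperm p q).

Lemma casimirLE S (f : Tens) i : casimirL S f i = casimir S f i.
Proof.
rewrite add_lfunE scale_lfunE id_lfunE !ffunE; congr (_ + _).
rewrite sum_lfunE sum_ffunE; apply: eq_bigr => p _.
by rewrite sum_lfunE sum_ffunE; apply: eq_bigr => q _; rewrite renE.
Qed.

Lemma matchings_casimir m S (f : Tens) :
  f \in matchings m S -> casimirL S f \in matchings m S.
Proof.
move=> fG; rewrite add_lfunE scale_lfunE id_lfunE memvD ?memvZ //.
rewrite sum_lfunE memv_suml // => p pS.
rewrite sum_lfunE memv_suml // => q /andP[qS _].
have -> : S = tperm p q @: S; last exact: matchings_ren.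
apply/setP => r; rewrite -[r in RHS](tpermK p q) (mem_imset _ _ perm_inj).
by case: tpermP => // ->; rewrite ?pS ?qS.
Qed.

(** [casimirL] is injective and preserves the span of the matchings, so it
    also reflects it. *)
Lemma casimir_matchings m S (f : Tens) : (0 < #|S|)%N ->
  casimirL S f \in matchings m S -> f \in matchings m S.
Proof.
move=> S0 TfG.
have k0 : lker (casimirL S) == 0%VS.
  rewrite -subv0; apply/subvP => g; rewrite memv_ker memv0 => /eqP g0.
  apply/eqP/ffunP => i; rewrite ffunE.
  by apply: (casimir_pos S0) => j; rewrite -casimirLE g0 ffunE.
have sub : (casimirL S @: matchings m S <= matchings m S)%VS.
  by apply/subvP => _ /memv_imgP[g gG ->]; apply: matchings_casimir.
have /eqP e : (casimirL S @: matchings m S)%VS == matchings m S.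
  by rewrite eqEdim sub limg_dim_eq ?leqnn // (eqP k0) capv0.
move: TfG; rewrite -{1}e => /memv_imgP[g gG] /(lker0P k0) -> //.
Qed.

Lemma contr_depends S p q (f : Idx -> C) : p != q -> depends S f ->
  depends (S :\ p :\ q) (contr p q f).
Proof.
move=> ne Df i j e; apply: eq_bigr => b _; apply: eq_bigr => c _.
congr (_ * _); apply: Df => r rS; rewrite !ffunE.
by case: eqP => // /eqP rq; case: eqP => // /eqP rp; rewrite e // !inE rp rq.
Qed.

(** Contraction with J commutes with sp(n): the terms acting in the two
    contracted slots add up to X^T J + J X = 0. *)
Lemma contr_inv S p q (f : Idx -> C) : p \in S -> q \in S -> p != q -> lie_inv S f ->
  lie_inv (S :\ p :\ q) (contr p q f).
Proof.
move=> pS qS ne If u i.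
have : (u *m u^T *m J)^T *m J + J *m (u *m u^T *m J) = 0.
  by rewrite !trmx_mul trmxK JT !mulmxA !mulNmx addNr.
move: (u *m u^T *m J) {If}(If u) => X If spX.
have {}spX a c : \sum_b (X b a * J b c + J a b * X b c) = 0.
  move/matrixP/(_ a c): spX; rewrite !mxE -big_split /= => e.
  by rewrite -[RHS]e; apply: eq_bigr => b _; rewrite mxE.
transitivity (\sum_b \sum_c J b c * lie_act X S f (upd (upd i p b) q c)); last first.
  by apply: big1 => b _; apply: big1 => c _; rewrite If mulr0.
pose F x y := f (upd (upd i p x) q y).
have termE b c : lie_act X S f (upd (upd i p b) q c) =
    \sum_d (X b d * F d c + X c d * F b d) +
    \sum_(r in S :\ p :\ q)
      \sum_d X (i r) d * f (upd (upd (upd i r d) p b) q c).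
  rewrite /lie_act (big_setD1 p) //= (big_setD1 q) /=; last first.
    by rewrite !inE eq_sym ne.
  rewrite addrA -big_split /=. congr (_ + _).
    apply: eq_bigr => d _; rewrite updE updN // updE upd_upd; congr (_ + _).
    by rewrite -[in LHS]updC // upd_upd.
  apply: eq_bigr => r; rewrite !inE => /and3P[rq rp _].
  apply: eq_bigr => d _; rewrite !updN //.
  by rewrite (@updC _ q r) 1?eq_sym // (@updC i p r) // eq_sym.
under [RHS]eq_bigr do under eq_bigr do rewrite termE mulrDr.
under [RHS]eq_bigr do rewrite big_split /=.
rewrite big_split /= [X in _ = X + _](_ : _ = 0) ?add0r.
  rewrite /lie_act; symmetry.
  under eq_bigr do under eq_bigr do rewrite mulr_sumr.
  under eq_bigr do rewrite exchange_big /=.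
  rewrite exchange_big; apply: eq_bigr => r _ /=.
  under eq_bigr do under eq_bigr do rewrite mulr_sumr.
  under eq_bigr do rewrite exchange_big /=.
  rewrite exchange_big; apply: eq_bigr => d _ /=.
  rewrite /contr mulr_sumr; apply: eq_bigr => b _.
  by rewrite mulr_sumr; apply: eq_bigr => c _; rewrite mulrCA.
transitivity (\sum_x \sum_y F x y * \sum_b (X b x * J b y + J x b * X b y)).
  under eq_bigr do under eq_bigr do rewrite big_split mulrDr /= !mulr_sumr.
  under [RHS]eq_bigr do under eq_bigr do rewrite big_split mulrDr /= !mulr_sumr.
  under eq_bigr do rewrite big_split /=.
  under [RHS]eq_bigr do rewrite big_split /=.
  rewrite !big_split /=; congr (_ + _).
    rewrite [LHS](eq_bigr _ (fun b _ => exchange_big _ _ _ _ _ _)) /=.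
    rewrite exchange_big; apply: eq_bigr => x _ /=.
    rewrite exchange_big; apply: eq_bigr => y _ /=.
    by apply: eq_bigr => b _; rewrite mulrA [RHS]mulrC [X in X * _]mulrC.
  apply: eq_bigr => x _; rewrite exchange_big; apply: eq_bigr => y _ /=.
  by apply: eq_bigr => b _; rewrite mulrA [RHS]mulrC.
by apply: big1 => x _; apply: big1 => y _; rewrite spX mulr0.
Qed.

(** The first fundamental theorem. On an invariant tensor [casimir_slot] turns
    [casimir] into a sum of contraction terms, which are matchings by induction,
    and [casimir_matchings] removes [casimir]. *)
Theorem symplectic_fft m S (f : Tens) : #|S| = m.*2 -> depends S f -> lie_inv S f ->
  f \in matchings m S.
Proof.
elim: m S f => [|m IHm] S f cS Df If.
  have S0 : S = set0 by apply/eqP; rewrite -cards_eq0 cS.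
  apply/vlineP; case: (pickP (fun _ : Idx => true)) => [i0 _|noidx].
    exists (f i0); apply/ffunP => i; rewrite !ffunE /GRing.scale /= mulr1.
    by apply: Df => p; rewrite S0 inE.
  by exists 0; apply/ffunP => i; have := noidx i.
apply: casimir_matchings; first by rewrite cS.
pose K p q : Tens := [ffun i => contr p q f i].
have -> : casimirL S f = \sum_(p in S) \sum_(q in S | q != p) mulJ p q (K p q).
  apply/ffunP => i; rewrite casimirLE /casimir sum_ffunE.
  rewrite mulnC natrM -mulrA mulr_natl -sumr_const -big_split /=.
  apply: eq_bigr => p pS; rewrite sum_ffunE.
  under [RHS]eq_bigr do rewrite mulJE ffunE.
  apply/eqP; rewrite -subr_eq0 -addrA -sumrB.
  exact/eqP/casimir_slot.
apply: memv_suml => p pS; apply: memv_suml => q /andP[qS ne].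
apply: matchings_mul => //; apply: IHm.
- move: cS; rewrite (cardsD1 p) pS (cardsD1 q) !inE ne qS.
  by rewrite !add1n doubleS => -[].
- move=> i j e; rewrite !ffunE; apply: contr_depends e => //.
  by rewrite eq_sym.
move=> u i; rewrite -[RHS](@contr_inv S p q f pS qS _ If u i) 1?eq_sym //.
by apply: eq_bigr => r _; apply: eq_bigr => c _; rewrite ffunE.
Qed.



(** Diagonal action of a matrix on tensors with all slots [P]. *)
Definition diag_act (g : 'M[C]_n) (f : Idx -> C) i : C :=
  \sum_(j : Idx) (\prod_p g (i p) (j p)) * f j.

Lemma eq_act g (f f' : Idx -> C) : f =1 f' -> diag_act g f =1 diag_act g f'.
Proof. by move=> e i; apply: eq_bigr => j _; rewrite e. Qed.

Lemma actM g h (f : Idx -> C) i : diag_act g (diag_act h f) i = diag_act (g *m h) f i.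
Proof.
rewrite /diag_act; under eq_bigr do rewrite mulr_sumr.
rewrite exchange_big; apply: eq_bigr => j _ /=.
under eq_bigr do rewrite mulrA -big_split /=.
rewrite -mulr_suml; congr (_ * _); under [RHS]eq_bigr do rewrite mxE.
by rewrite bigA_distr_bigA.
Qed.

Lemma prod_delta i j : \prod_p (i p == j p)%:R = (i == j)%:R :> C.
Proof.
case: eqP => [->|/eqP ne]; first by rewrite big1 // => p _; rewrite eqxx.
have /existsP[p /negPf np] : [exists p, i p != j p].
  by rewrite -negb_forall; apply: contraNN ne => /forallP e; apply/eqP/ffunP => p; apply/eqP.
by rewrite (bigD1 p) //= np mul0r.
Qed.

Lemma act1 (f : Idx -> C) i : diag_act 1%:M f i = f i.
Proof.
rewrite /diag_act (bigD1 i) //= [X in _ + X]big1 ?addr0 => [|j ne].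
  by under eq_bigr do rewrite mxE; rewrite prod_delta eqxx mul1r.
by under eq_bigr do rewrite mxE; rewrite prod_delta eq_sym (negPf ne) mul0r.
Qed.

(** The action of 1 + t X as a polynomial in t, whose linear coefficient is the
    action of the Lie algebra element X ([act_poly_deriv]). *)
Definition act_poly X (f : Idx -> C) i : {poly C} :=
  \sum_(j : Idx) (f j)%:P * \prod_p ((i p == j p)%:R%:P + X (i p) (j p) *: 'X).

Lemma act_polyE X (f : Idx -> C) i t : (act_poly X f i).[t] = diag_act (1%:M + t *: X) f i.
Proof.
rewrite horner_sum; apply: eq_bigr => j _.
rewrite hornerCM horner_prod mulrC; congr (_ * _); apply: eq_bigr => p _.
by rewrite !hornerE !mxE mulrC.
Qed.

Lemma act_poly_deriv X (f : Idx -> C) i :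
  ((act_poly X f i)^`()).[0] = lie_act X setT f i.
Proof.
rewrite /lie_act; under [RHS]eq_bigl do rewrite in_setT.
rewrite /act_poly deriv_sum horner_sum.
under [LHS]eq_bigr => j _.
  rewrite derivM derivC mul0r add0r hornerCM.
  rewrite (eq_bigl [in [set: P]]); last by move=> p; rewrite in_setT.
  rewrite deriv_prod horner_sum (eq_bigl xpredT); last by move=> p; rewrite in_setT.
  rewrite mulr_sumr; over.
rewrite exchange_big; apply: eq_bigr => p _ /=.
have termE j : f j * (((i p == j p)%:R%:P + X (i p) (j p) *: 'X)^`() *
    \prod_(q in [set: P] :\ p) ((i q == j q)%:R%:P + X (i q) (j q) *: 'X)).[0] =
    (i == upd j p (i p))%:R * (X (i p) (j p) * f j).
  rewrite derivD derivC add0r derivZ derivX alg_polyC hornerCM horner_prod.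
  rewrite mulrCA mulrA [RHS]mulrC; congr (_ * _).
  rewrite -prod_delta [RHS](bigD1 p) //= updE eqxx mul1r; apply: eq_big => [q|q].
    by rewrite !inE andbT.
  by rewrite !inE => /andP[ne _]; rewrite updN // !hornerE.
under eq_bigr do rewrite termE.
rewrite (bigID (fun j => i == upd j p (i p))) /= [X in _ + X]big1 ?addr0; last first.
  by move=> j /negPf->; rewrite mul0r.
rewrite (reindex_onto (upd i p) (fun j => j p)) /=; last first.
  by move=> j /eqP->; rewrite upd_upd upd_id.
apply: eq_big => [c|c _]; first by rewrite updE upd_upd upd_id !eqxx.
by rewrite updE upd_upd upd_id eqxx mul1r.
Qed.

(** Semi-invariance suffices: the character by which the unipotent group of the
    1 + t X acts is a polynomial c with c(t) c(-t) = 1, hence trivial. *)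
Lemma semi_inv_lie X (f : Idx -> C) : X *m X = 0 ->
  (forall t, exists z : C, forall i, diag_act (1%:M + t *: X) f i = z * f i) ->
  forall i, lie_act X setT f i = 0.
Proof.
move=> XX semi i.
case: (pickP (fun j => f j != 0)) => [i0 nz|f0]; last first.
  rewrite /lie_act big1 // => p _; rewrite big1 // => c _.
  by have /negbFE/eqP-> := f0 (upd i p c); rewrite mulr0.
have [chi cE] : exists chi : {poly C}, forall t j,
    diag_act (1%:M + t *: X) f j = chi.[t] * f j.
  exists ((f i0)^-1 *: act_poly X f i0) => t j.
  have [a aE] := semi t; rewrite hornerZ act_polyE !aE mulrCA mulVf //.
  by rewrite mulr1.
(* (1 + t X)(1 - t X) = 1 because X^2 = 0 *)
have c1 : chi * (chi \Po - 'X) = 1.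
  apply: poly_ext => t; rewrite hornerM horner_comp !hornerE.
  apply: (mulIf nz); rewrite mul1r -mulrA -cE.
  rewrite -[RHS]act1 -[in RHS](_ : (1%:M + (- t) *: X) *m (1%:M + t *: X) = 1%:M).
    rewrite -actM (eq_act _ (cE t)) /diag_act mulr_sumr.
    by apply: eq_bigr => j _; rewrite mulrCA.
  rewrite mulmxDl !mulmxDr mul1mx mul1mx mulmx1 -scalemxAl -scalemxAr XX !scaler0.
  by rewrite addr0 scaleNr addrK.
have c_const : chi = 1.
  have := c1; have := size_mul_eq1 chi (chi \Po - 'X); rewrite c1 size_poly1 eqxx.
  move/esym/andP=> [/size_poly1P[a _ ca] _] _; rewrite ca; congr _%:P.
  have := cE 0 i0; rewrite scale0r addr0 act1 -{1}[f i0]mul1r => /(mulIf nz).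
  by rewrite ca hornerC.
have qE : act_poly X f i = (f i)%:P.
  by apply: poly_ext => t; rewrite act_polyE cE c_const -polyC1 !hornerC mul1r.
by rewrite -act_poly_deriv qE derivC horner0.
Qed.

Lemma semi_inv_lie_inv (f : Idx -> C) :
  (forall (u : 'cV[C]_n) t, exists z : C, forall i,
     diag_act (1%:M + t *: (u *m u^T *m J)) f i = z * f i) ->
  lie_inv setT f.
Proof.
move=> semi u; apply: semi_inv_lie (semi u).
have uJu : u^T *m J *m u = 0 := skew_form_self u JT.
by rewrite -!mulmxA (mulmxA u^T) (mulmxA (u^T *m J)) uJu !(mul0mx, mulmx0).
Qed.

End Tensors.

(** * Interior products in an exterior algebra *)

Section Contraction.
Variables (F : fieldType) (U : vectType F).
Local Notation m := (\dim {:U}).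
Local Notation E := (exterior U).
Local Notation e := (vbasis {:U}).
Implicit Types (S A B D : {set 'I_m}) (u : U) (x y z : E) (j k : 'I_m).

Lemma gbasis_min S : S != set0 -> exists2 j, j \in S &
  (gbasis F S : E) = eta e`_j * (gbasis F (S :\ j) : E).
Proof.
case/ex_min => j jS jmin; exists j => //.
rewrite eta_vbasis gbasis_mul wsign_min ?scale1r ?setD1K // => k.
rewrite !inE => /andP[ne /jmin].
by rewrite leq_eqVlt eq_sym (inj_eq val_inj) (negPf ne).
Qed.

Definition lin_closed (V : lmodType F) (Q : V -> Prop) :=
  forall a (x y : V), Q x -> Q y -> Q (a *: x + y).

Lemma lin_closed_sum (V : lmodType F) (Q : V -> Prop) (I : Type) (r : seq I)
    (P : pred I) (c : I -> F) (f : I -> V) :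
  lin_closed Q -> Q 0 -> (forall i, P i -> Q (f i)) ->
  Q (\sum_(i <- r | P i) c i *: f i).
Proof.
move=> QD Q0 Qf; elim: r => [|i r IHr]; first by rewrite big_nil.
by rewrite big_cons; case: ifP => // /Qf Qi; apply: QD.
Qed.

Lemma extpow_gbasis d x : x \in extpow U d ->
  exists c : {set 'I_m} -> F, x = \sum_(S : {set 'I_m} | #|S| == d) c S *: (gbasis F S : E).
Proof.
rewrite extpowE => /memv_sumP[f fP ->].
exists (fun S => f S S); apply: eq_bigr => S Sd.
have /vlineP[a ->] := fP S Sd.
by rewrite !ffunE eqxx /GRing.scale /= mulr1.
Qed.

Lemma gbasis_extpow S : (gbasis F S : E) \in extpow U #|S|.
Proof. by rewrite -prod_eta_vbasis prod_eta_extpow. Qed.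

Lemma extpow0_ind (Q : E -> Prop) : lin_closed Q -> Q 0 -> Q 1 ->
  forall x, x \in extpow U 0 -> Q x.
Proof.
move=> QD Q0 Q1 x; rewrite /extpow expv0 => /vlineP[a ->].
by rewrite -[_ *: _]addr0; apply: QD.
Qed.

Lemma extpowS_ind d (Q : E -> Prop) : lin_closed Q -> Q 0 ->
  (forall u y, y \in extpow U d -> Q (eta u * y)) ->
  forall x, x \in extpow U d.+1 -> Q x.
Proof.
move=> QD Q0 Qe x /extpow_gbasis[c ->]; apply: lin_closed_sum => // S /eqP cS.
have [|j jS ->] := @gbasis_min S; first by rewrite -cards_eq0 cS.
apply: Qe; rewrite -[d](_ : #|S :\ j| = d) ?gbasis_extpow //.
by move: cS; rewrite (cardsD1 j) jS => -[].
Qed.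

Lemma extpow_mul a b x y :
  x \in extpow U a -> y \in extpow U b -> x * y \in extpow U (a + b).
Proof. by move=> xa yb; rewrite /extpow expvD memv_mul. Qed.

Lemma eta_extpow u : eta u \in extpow U 1.
Proof. by rewrite /extpow expv1 eta_limg. Qed.

Lemma one_extpow : (1 : E) \in extpow U 0.
Proof. by rewrite /extpow expv0 memv_line. Qed.

Lemma ext_ind (Q : E -> Prop) : lin_closed Q -> Q 0 -> Q 1 ->
  (forall u y, Q y -> Q (eta u * y)) -> forall x, Q x.
Proof.
move=> QD Q0 Q1 Qe x; have QS d y : y \in extpow U d -> Q y.
  elim: d y => [|d IHd]; first exact: extpow0_ind.
  by apply: extpowS_ind => // u y /IHd; apply: Qe.
rewrite [x]gbasisE; apply: lin_closed_sum => // S _; apply: QS.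
exact: gbasis_extpow.
Qed.

(** Graded commutativity. *)
Lemma super_comm a b x y : x \in extpow U a -> y \in extpow U b ->
  x * y = (-1) ^+ (a * b) *: (y * x).
Proof.
have comm1 u c z : z \in extpow U c -> eta u * z = (-1) ^+ c *: (z * eta u).
  elim: c z => [|c IHc].
    apply: extpow0_ind => [r z z' e1 e2||].
    - by rewrite mulrDr mulrDl -scalerAl -scalerAr e1 e2 !expr0 !scale1r.
    - by rewrite mulr0 mul0r scaler0.
    - by rewrite mulr1 mul1r scale1r.
  apply: extpowS_ind => [r z z' e1 e2||w z zc].
  - rewrite mulrDr mulrDl -scalerAl -scalerAr e1 e2 scalerDr !scalerA.
    by rewrite [r * _]mulrC.
  - by rewrite mulr0 mul0r scaler0.
  by rewrite mulrA eta_anti mulNr -[in LHS]mulrA IHc // -scalerAr mulrA exprS mulN1r scaleNr.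
elim: a x => [|a IHa].
  apply: extpow0_ind => [r z z' e1 e2 yb||].
  - by rewrite mulrDr mulrDl -scalerAl -scalerAr e1 // e2 // !expr0 !scale1r.
  - by rewrite mulr0 mul0r scaler0.
  - by rewrite mulr1 mul1r scale1r.
move=> x xa yb; move: x xa; apply: extpowS_ind => [r z z' e1 e2||w z zc].
- rewrite mulrDr mulrDl -scalerAl -scalerAr e1 e2 scalerDr !scalerA.
  by rewrite [r * _]mulrC.
- by rewrite mulr0 mul0r scaler0.
rewrite -mulrA IHa // -scalerAr [in LHS]mulrA (comm1 _ _ _ yb) -scalerAl scalerA.
by rewrite -exprD addnC -mulSn mulrA.
Qed.

(** Interior product with the j-th coordinate form: the transpose of left
    multiplication by the j-th generator. *)
Definition iprod1 j y : E := [ffun B : {set 'I_m} => wsign F [set j] B * y (j |: B) : F^o].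

Fact iprod1_linear j : linear (iprod1 j).
Proof.
by move=> a x y; apply/ffunP => B; rewrite !ffunE mulrDr /GRing.scale /= mulrCA.
Qed.
HB.instance Definition _ j := GRing.isLinear.Build F E E _ (iprod1 j) (iprod1_linear j).

Lemma gbasis1_mulE k y D : ((gbasis F [set k] : E) * y) D =
  if k \in D then wsign F [set k] (D :\ k) * y (D :\ k) else 0.
Proof.
rewrite -[_ * y]/(gmul _ _) /gmul (bigD1 [set k]) //= [X in _ + X]big1 ?addr0; last first.
  by move=> A ne; apply: big1 => B _; rewrite ffunE (negPf ne) !mul0r scale0r.
rewrite sum_ffunE.
under eq_bigr do rewrite !ffunE eqxx mul1r.
case: ifPn => kD; last first.
  apply: big1 => B _; case: eqP => [eD|_]; last by rewrite scaler0.
  by rewrite eD setU11 in kD.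
rewrite (bigD1 (D :\ k)) //= setD1K // eqxx /GRing.scale /= mulr1 mulrC.
rewrite big1 ?addr0 // => B ne.
rewrite /wsign disjoints1; case: ifPn => kB; last by rewrite mulr0 mul0r.
case: eqP => [eD|_]; last by rewrite mulr0.
by rewrite eD setU1K ?eqxx in ne.
Qed.

Lemma wsign_sq k B : k \notin B -> wsign F [set k] B * wsign F [set k] B = 1.
Proof. by move=> kB; rewrite /wsign disjoints1 kB -expr2 sqrr_sign. Qed.

(** The canonical anticommutation relations between interior and exterior
    multiplication. *)
Lemma iprod1_mul j k y :
  iprod1 j ((gbasis F [set k] : E) * y) =
  (j == k)%:R *: y - (gbasis F [set k] : E) * iprod1 j y.
Proof.
apply/eqP; rewrite eq_sym subr_eq; apply/eqP/ffunP => B.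
rewrite !ffunE !gbasis1_mulE ffunE /GRing.scale /=.
have [->|ne] := eqVneq j k.
  rewrite mul1r setU11; have [kB|kB] := boolP (k \in B).
    rewrite {1}/wsign disjoints1 kB mul0r add0r mulrA wsign_sq ?mul1r ?setD1K //.
    by rewrite !inE eqxx.
  by rewrite addr0 setU1K // mulrA wsign_sq // mul1r.
rewrite mul0r !inE eq_sym (negPf ne) /=.
have [kB|_] := boolP (k \in B); last by rewrite mulr0 addr0.
have [jB|jB] := boolP (j \in B).
  rewrite {1}/wsign disjoints1 jB mul0r add0r.
  by rewrite [wsign F [set j] _]/wsign disjoints1 !inE ne jB mul0r mulr0.
set B' := B :\ k; have eB : B = k |: B' by rewrite setD1K.
have kB' : k \notin B' by rewrite !inE eqxx.
have jB' : j \notin B' by rewrite !inE negb_and jB orbT.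
have -> : (j |: B) :\ k = j |: B'.
  by apply/setP => l; rewrite !inE; case: (eqVneq l k) => // ->; rewrite eq_sym (negPf ne).
have w2 a b : a != b -> b \notin B' -> a \notin B' ->
    wsign F [set a] (b |: B') = (-1) ^+ (b < a)%N * wsign F [set a] B'.
  move=> ab bB' aB'; rewrite /wsign !disjoints1 in_setU1 (negPf ab) (negPf aB') /=.
  by rewrite ninvUr ?disjoints1 // exprD /ninv !big_set1.
rewrite eB !w2 //; last by rewrite eq_sym.
rewrite !mulrA -mulrDl; apply/esym/eqP; rewrite mulf_eq0; apply/orP; left.
rewrite (_ : _ * _ * _ * _ = - (wsign F [set k] B' * wsign F [set j] B')) ?addNr //.
case: ltngtP => [_|_|/val_inj ejk]; last by rewrite ejk eqxx in ne.
  by rewrite expr0 expr1; ring.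
by rewrite expr0 expr1; ring.
Qed.

(** Interior product with a linear form. Only the values of [f] on the basis
    enter, so that linearity is a hypothesis of the lemmas and not part of the
    type of [f]. *)
Definition iprod (f : U -> F) y : E := \sum_(j < m) f e`_j *: iprod1 j y.

Fact iprod_linear f : linear (iprod f).
Proof.
move=> a x y; rewrite /iprod scaler_sumr -big_split; apply: eq_bigr => j _ /=.
by rewrite linearP scalerDr !scalerA mulrC.
Qed.
HB.instance Definition _ f := GRing.isLinear.Build F E E _ (iprod f) (iprod_linear f).

Lemma eq_iprod f g y : f =1 g -> iprod f y = iprod g y.
Proof. by move=> e; apply: eq_bigr => j _; rewrite e. Qed.

Lemma iprod_comb (T : finType) (c : T -> F) (f : T -> U -> F) y :
  iprod (fun u => \sum_t c t * f t u) y = \sum_t c t *: iprod (f t) y.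
Proof.
rewrite /iprod; under [RHS]eq_bigr do rewrite scaler_sumr.
rewrite exchange_big; apply: eq_bigr => j _ /=.
by rewrite scaler_suml; apply: eq_bigr => t _; rewrite scalerA.
Qed.

Lemma iprod_one f : iprod f 1 = 0.
Proof.
apply: big1 => j _; rewrite -[RHS](scaler0 _ (f e`_j)); congr (_ *: _).
apply/ffunP => B; rewrite !ffunE; case: eqP; last by rewrite mulr0.
by move=> /setP/(_ j); rewrite !inE eqxx.
Qed.

(** The interior product is an antiderivation; with [iprod_one] this determines
    it, and makes it natural in the vector space ([iprod_extmap]). *)
Lemma iprod_eta (f : U -> F) u y : linear_for *%R f ->
  iprod f (eta u * y) = f u *: y - eta u * iprod f y.
Proof.
move=> fl; have f0 : f 0 = 0.
  by have := fl (-1) 0 0; rewrite scaler0 addr0 mulN1r addNr.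
have -> : f u = \sum_(k < m) coord e k u * f e`_k.
  rewrite {1}(coord_vbasis (memvf u)).
  elim: (index_enum _) => [|k r IHr]; first by rewrite !big_nil.
  by rewrite !big_cons fl IHr.
rewrite {1 2}/eta !mulr_suml linear_sum scaler_suml -sumrB; apply: eq_bigr => k _.
rewrite -!scalerAl linearZ /= -scalerA -scalerBr; congr (_ *: _).
rewrite /iprod mulr_sumr (bigD1 k) //= iprod1_mul eqxx scale1r.
rewrite [in RHS](bigD1 k) //= scalerBr opprD addrA -scalerAr; congr (_ + _).
rewrite -sumrN; apply: eq_bigr => j ne.
by rewrite iprod1_mul (negPf ne) scale0r sub0r scalerN -scalerAr.
Qed.

Lemma iprod_extpow f d y : linear_for *%R f -> y \in extpow U d.+1 ->
  iprod f y \in extpow U d.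
Proof.
move=> fl; elim: d y => [|d IHd]; apply: extpowS_ind => [a x y h1 h2||u y yd].
- by rewrite linearP memvD ?memvZ.
- by rewrite linear0 mem0v.
- rewrite iprod_eta //; move: y yd; apply: extpow0_ind => [a x y h1 h2||].
  + rewrite [iprod f _]linearP mulrDr -scalerAr scalerDr opprD.
    rewrite [X in X + _ + _](_ : _ = a *: (f u *: x)); last by rewrite !scalerA mulrC.
    rewrite addrACA -scalerBr; exact: memvD (memvZ _ h1) h2.
  + by rewrite [iprod f _]linear0 mulr0 scaler0 subr0 mem0v.
  + by rewrite iprod_one mulr0 subr0 memvZ // one_extpow.
- by rewrite linearP memvD ?memvZ.
- by rewrite linear0 mem0v.
rewrite iprod_eta // memvB ?memvZ //.
by rewrite -[d.+1]add1n extpow_mul ?eta_extpow ?IHd.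
Qed.
End Contraction.

Lemma iprod_extmap (F : fieldType) (U V : vectType F) (f : 'Hom(U, V))
    (g : V -> F) y : linear_for *%R g ->
  iprod g (extmap f y) = extmap f (iprod (g \o f) y).
Proof.
move=> gl; have [h1 h0 h2] := extmap_morph f.
move: y; apply: ext_ind => [a x y e1 e2|||u y IH].
- by rewrite !linearP /= e1 e2.
- by rewrite !linear0.
- by rewrite h0 !iprod_one linear0.
have gfl : linear_for *%R (g \o f) by move=> a v w; rewrite /= linearP gl.
by rewrite h2 h1 (iprod_eta _ _ gl) IH (iprod_eta _ _ gfl) linearB linearZ /= h2 h1.
Qed.

Lemma sum_tuple_recl (V : nmodType) (T : finType) d (G : d.+1.-tuple T -> V) :
  \sum_t G t = \sum_s \sum_(t : d.-tuple T) G [tuple of s :: t].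
Proof.
rewrite pair_bigA (reindex (fun x : T * d.-tuple T => [tuple of x.1 :: x.2])) //=.
exists (fun t => (thead t, [tuple of behead t])) => [[s t] _|t _] /=.
  by rewrite theadE; congr pair; apply: val_inj.
by rewrite [RHS]tuple_eta.
Qed.

Section IteratedContraction.
Variables (F : fieldType) (U : vectType F) (T : finType).
Variables (lam : T -> U -> F) (v : T -> U).
Local Notation E := (exterior U).
Hypothesis lamL : forall s, linear_for *%R (lam s).

(** Iterated interior product, with values in the degree zero part. Up to a
    scalar it is a section of the map from tensors to the exterior algebra
    ([iter_iprod_euler]), and it is equivariant ([iter_iprod_extmap]). *)
Fixpoint iter_iprod (t : seq T) (x : E) : F :=
  if t is s :: t' then iter_iprod t' (iprod (lam s) x) else x set0.

Lemma iter_iprod_comb (I : finType) t (c : I -> F) (x : I -> E) :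
  iter_iprod t (\sum_i c i *: x i) = \sum_i c i * iter_iprod t (x i).
Proof.
elim: t x => [|s t IHt] x /=.
  by rewrite sum_ffunE; apply: eq_bigr => i _; rewrite ffunE.
by rewrite -IHt linear_sum; congr iter_iprod; apply: eq_bigr => i _; rewrite linearZ.
Qed.

Lemma iter_iprod_scale t c x : iter_iprod t (c *: x) = c * iter_iprod t x.
Proof. by elim: t x => [|s t IHt] x /=; rewrite ?ffunE // linearZ IHt. Qed.

Variable c : F.
Hypothesis cE : forall u, \sum_s lam s u *: v s = c *: u.

(** Euler's identity: the left side is a derivation that multiplies each vector
    by [c]. *)
Lemma euler d (x : E) : x \in extpow U d ->
  \sum_s eta (v s) * iprod (lam s) x = (c *+ d) *: x.
Proof.
elim: d x => [|d IHd].
  apply: extpow0_ind => [a x y e1 e2||].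
  - rewrite mulr0n scale0r; move: e1 e2; rewrite mulr0n !scale0r => e1 e2.
    under eq_bigr do rewrite linearP mulrDr -scalerAr.
    by rewrite big_split /= -scaler_sumr e1 e2 scaler0 addr0.
  - by rewrite scaler0 big1 // => s _; rewrite linear0 mulr0.
  - by rewrite mulr0n scale0r big1 // => s _; rewrite iprod_one mulr0.
apply: extpowS_ind => [a x y e1 e2||u y yd].
- under eq_bigr do rewrite linearP mulrDr -scalerAr.
  by rewrite big_split /= -scaler_sumr e1 e2 scalerDr !scalerA [a * _]mulrC.
- by rewrite scaler0 big1 // => s _; rewrite linear0 mulr0.
under eq_bigr do rewrite iprod_eta // mulrBr -scalerAr mulrA eta_anti mulNr opprK -mulrA.
rewrite big_split /= -mulr_sumr IHd // -scalerAr.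
under eq_bigr do rewrite scalerAl -linearZ /=.
by rewrite -mulr_suml -linear_sum cE linearZ -scalerAl -scalerDl mulrS.
Qed.

Lemma iter_iprod_euler d (x : E) : x \in extpow U d ->
  \sum_(t : d.-tuple T) iter_iprod t x *: \prod_(s <- t) eta (v s) =
  (c ^+ d *+ d`!) *: x.
Proof.
elim: d x => [|d IHd] x xd.
  rewrite (bigD1 [tuple]) //= [X in _ + X]big1 ?addr0 => [|t /negP[]]; last exact/eqP/tuple0.
  rewrite big_nil expr0 mulr1n scale1r; move: x xd.
  apply: extpow0_ind => [a x y e1 e2||].
  - by rewrite -{2}e1 -{2}e2 !ffunE scalerDl scalerA.
  - by rewrite ffunE scale0r.
  - by rewrite ffunE eqxx scale1r.
rewrite sum_tuple_recl.
under eq_bigr => s _.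
  under eq_bigr do rewrite /= big_cons scalerAr.
  rewrite -mulr_sumr IHd; last exact: iprod_extpow.
  rewrite -scalerAr; over.
rewrite -scaler_sumr (euler xd) scalerA factS exprSr.
by rewrite mulrnAl mulrnAr -mulrnA.
Qed.

Variables (f : 'End(U)) (M : T -> T -> F).
Hypothesis lamM : forall s u, lam s (f u) = \sum_s' M s s' * lam s' u.

Lemma iter_iprod_extmap d (t : d.-tuple T) x :
  iter_iprod t (extmap f x) =
  \sum_(t' : d.-tuple T) (\prod_(r < d) M (tnth t r) (tnth t' r)) * iter_iprod t' x.
Proof.
have h0 y : (extmap f y) set0 = y set0.
  have [h1 h0 h2] := extmap_morph f.
  move: y; apply: ext_ind => [a y z e1 e2|||u y _].
  - by rewrite linearP !ffunE /= e1 e2.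
  - by rewrite linear0.
  - by rewrite h0.
  rewrite h2 h1 /eta !mulr_suml !sum_ffunE !big1 // => k _;
    by rewrite -scalerAl ffunE gbasis1_mulE inE scaler0.
elim: d t x => [|d IHd] t x.
  rewrite (bigD1 [tuple]) //= [X in _ + X]big1 ?addr0 => [|t' /negP[]]; last exact/eqP/tuple0.
  by rewrite big_ord0 mul1r (tuple0 t) /= h0.
case/tupleP: t => s t /=; rewrite sum_tuple_recl iprod_extmap //.
rewrite (eq_iprod (g := fun u => \sum_s' M s s' * lam s' u)); last exact: lamM.
rewrite iprod_comb linear_sum /=.
under eq_bigr do rewrite linearZ /=.
rewrite iter_iprod_comb; apply: eq_bigr => s' _; rewrite IHd mulr_sumr.
apply: eq_bigr => t' _; rewrite mulrA; congr (_ * _).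
rewrite big_ord_recl !tnth0; congr (_ * _).
by apply: eq_bigr => r _; rewrite !tnthS.
Qed.

End IteratedContraction.

(** * The generic skew matrix and its traces *)

Lemma mulmx_sandwich (R : pzRingType) n (A B D E F H : 'M[R]_n) :
  E *m F *m H = F ->
  (A *m B *m E) *m F *m (H *m D *m E) = A *m (B *m F *m D) *m E.
Proof. by move=> {2}<-; rewrite !mulmxA. Qed.

Section Forms.
Variables (C : numClosedFieldType) (n : nat).
Local Notation I := 'I_n.
Local Notation V := 'cV[C]_n.
Local Notation U := (subvs_of (extpow V 2)).
Local Notation W := (exterior U).
Implicit Types (a b c : I) (u : U) (g : 'M[C]_n) (l : nat).

Definition evec a : V := delta_mx a 0.
Definition vcoord a (v : V) : C := v a 0.

Lemma vcoord_lin a : linear_for *%R (vcoord a).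
Proof. by move=> r v w; rewrite /vcoord !mxE. Qed.

Lemma vcoord_sum (v : V) : \sum_a vcoord a v *: evec a = 1 *: v.
Proof.
rewrite scale1r; apply/matrixP => i j; rewrite ord1 summxE (bigD1 i) //= big1.
  by rewrite addr0 !mxE !eqxx mulr1.
by move=> a ne; rewrite !mxE eq_sym (negPf ne) mulr0.
Qed.

(** The products e_a /\ e_b for all pairs of indices form a frame of Lambda^2 V
    in which each basis vector occurs twice up to sign; [coord2] gives the skew
    coordinates, hence the factor 2 in [coord2_sum]. *)
Definition wedge2 (s : I * I) : U := vsproj (extpow V 2) (eta (evec s.1) * eta (evec s.2)).
Definition coord2 (s : I * I) u : C := iter_iprod vcoord [:: s.1; s.2] (vsval u).

Lemma wedge2E s : vsval (wedge2 s) = eta (evec s.1) * eta (evec s.2).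
Proof. by rewrite vsprojK // (@extpow_mul _ _ 1 1) ?eta_extpow. Qed.

Lemma coord2_lin s : linear_for *%R (coord2 s).
Proof.
move=> r u w; rewrite /coord2 /= linearP !(linearP (iprod _)).
by rewrite !ffunE.
Qed.

Lemma coord2_sum u : \sum_s coord2 s u *: wedge2 s = 2 *: u.
Proof.
apply: val_inj; rewrite linear_sum linearZ /=.
have := iter_iprod_euler vcoord_lin vcoord_sum (subvsP u).
rewrite expr1n => <-; rewrite sum_tuple_recl.
under [RHS]eq_bigr do rewrite sum_tuple_recl.
rewrite -(pair_bigA _ (fun a b => vsval (coord2 (a, b) u *: wedge2 (a, b)))) /=.
apply: eq_bigr => a _; apply: eq_bigr => b _.
rewrite (bigD1 [tuple]) //= [X in _ + X]big1 ?addr0 => [|t /negP[]]; last exact/eqP/tuple0.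
by rewrite !big_cons big_nil mulr1 wedge2E.
Qed.

Lemma coord2_act g s u : coord2 s (ext2_act g u) =
  \sum_s' g s.1 s'.1 * g s.2 s'.2 * coord2 s' u.
Proof.
rewrite /coord2 extpow_mapE.
have M a v : vcoord a (std_act g v) = \sum_a' g a a' * vcoord a' v.
  by rewrite lfunE /= /vcoord mxE.
rewrite (iter_iprod_extmap vcoord_lin M [tuple s.1; s.2]) sum_tuple_recl.
under eq_bigr do rewrite sum_tuple_recl.
rewrite -(pair_bigA _ (fun a b => g s.1 a * g s.2 b * coord2 (a, b) u)) /=.
apply: eq_bigr => a _; apply: eq_bigr => b _.
rewrite (bigD1 [tuple]) //= [X in _ + X]big1 ?addr0 => [|t /negP[]]; last exact/eqP/tuple0.
by rewrite 2!big_ord_recl big_ord0 mulr1.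
Qed.

Lemma ext2_act_wedge2 g s : ext2_act g (wedge2 s) =
  \sum_s' (g s'.1 s.1 * g s'.2 s.2) *: wedge2 s'.
Proof.
apply: val_inj; rewrite [LHS]extpow_mapE wedge2E [RHS]linear_sum.
have [h1 _ h2] := extmap_morph (std_act g).
rewrite h2 !h1.
have gE a : eta (std_act g (evec a)) = \sum_c g c a *: eta (evec c).
  rewrite lfunE /= -[g *m _]scale1r -vcoord_sum linear_sum; apply: eq_bigr => c _.
  rewrite linearZ; congr (_ *: _); rewrite /vcoord mxE (bigD1 a) //= big1 ?addr0.
    by rewrite !mxE !eqxx mulr1.
  by move=> b ne; rewrite !mxE (negPf ne) mulr0.
rewrite !gE mulr_suml.
rewrite -(pair_bigA _ (fun a b => vsval ((g a s.1 * g b s.2) *: wedge2 (a, b)))) /=.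
apply: eq_bigr => a _; rewrite mulr_sumr; apply: eq_bigr => b _.
by rewrite -scalerAl -scalerAr scalerA wedge2E.
Qed.

(** The generic skew-symmetric matrix with odd entries. *)
Definition gen_mx : 'M[W]_n := \matrix_(a, b) eta (wedge2 (a, b)).

Lemma gen_mx_extpow a b : gen_mx a b \in extpow U 1.
Proof. by rewrite mxE eta_extpow. Qed.

Lemma gen_mx_skew a b : gen_mx a b = - gen_mx b a.
Proof.
rewrite !mxE -linearN; congr eta; apply: val_inj.
by rewrite linearN /= !wedge2E eta_anti.
Qed.

Definition ext_act g : 'End(W) := extmap (ext2_act g).

Definition scalmx (A : 'M[C]_n) : 'M[W]_n := map_mx (in_alg W) A.

Lemma scalmxM A B : scalmx (A *m B) = scalmx A *m scalmx B.
Proof. exact: map_mxM. Qed.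

Lemma mul_scalmx_r (A : 'M[W]_n) B a b : (A *m scalmx B) a b = \sum_c B c b *: A a c.
Proof. by rewrite mxE; apply: eq_bigr => c _; rewrite mxE mulr_algr. Qed.

Lemma mul_scalmx_l (A : 'M[W]_n) B a b : (scalmx B *m A) a b = \sum_c B a c *: A c b.
Proof. by rewrite mxE; apply: eq_bigr => c _; rewrite mxE mulr_algl. Qed.

Lemma ext_act_gen_mx g : map_mx (ext_act g) gen_mx = scalmx g^T *m gen_mx *m scalmx g.
Proof.
have [h1 _ _] := extmap_morph (ext2_act g).
apply/matrixP => a b; rewrite mul_scalmx_r mxE [gen_mx a b]mxE h1 ext2_act_wedge2 linear_sum.
rewrite -(pair_bigA _ (fun c d => eta ((g c a * g d b) *: wedge2 (c, d)))) /=.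
rewrite [LHS]exchange_big; apply: eq_bigr => d _ /=; rewrite mul_scalmx_l scaler_sumr.
by apply: eq_bigr => c _; rewrite !mxE scalerA linearZ mulrC.
Qed.

Variable J : 'M[C]_n.
Hypotheses (JT : J^T = - J) (JJ : J *m J = - 1%:M).

(** [word l] is X (J X)^l with X = [gen_mx]: the factor X occurs [l + 1] times.
    It is locked because conversion between matrix products is expensive. *)
Definition word : nat -> 'M[W]_n :=
  locked (fun l => iter l (fun A => A *m scalmx J *m gen_mx) gen_mx).

Lemma word0 : word 0 = gen_mx. Proof. by rewrite /word -lock. Qed.

Lemma wordS l : word l.+1 = word l *m scalmx J *m gen_mx. Proof. by rewrite /word -lock. Qed.

(** The trace of (J X)^(l + 1). *)
Definition wtrace l : W := \sum_a \sum_b J a b *: word l b a.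

Lemma mulJmxE (A B : 'M[W]_n) a b :
  (A *m scalmx J *m B) a b = \sum_c \sum_d J c d *: (A a c * B d b).
Proof.
rewrite mxE [RHS]exchange_big; apply: eq_bigr => d _ /=; rewrite mul_scalmx_r mulr_suml.
by apply: eq_bigr => c _; rewrite scalerAl.
Qed.

Lemma word_cat l l' : word l *m scalmx J *m word l' = word (l + l').+1.
Proof.
elim: l' => [|l' IHl]; first by rewrite addn0 wordS word0.
rewrite addnS [word (l + l').+2]wordS -IHl wordS.
by move: (word l) (word l') (scalmx J) gen_mx => A B D E; rewrite (mulmxA (A *m D)) mulmxA.
Qed.

Lemma word_catE l l' a b :
  word (l + l').+1 a b = \sum_c \sum_d J c d *: (word l a c * word l' d b).
Proof. by rewrite -word_cat mulJmxE. Qed.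

Lemma word_extpow l a b : word l a b \in extpow U l.+1.
Proof.
elim: l a b => [|l IHl] a b; first by rewrite word0 gen_mx_extpow.
rewrite wordS mulJmxE; apply: memv_suml => c _; apply: memv_suml => d _.
by rewrite memvZ // -[l.+2]addn1 extpow_mul ?gen_mx_extpow.
Qed.

(** The sign produced by transposing [word l]: l + 1 skew matrices X and l skew
    matrices J, and the reversal of l + 1 anticommuting factors. *)
Fixpoint word_sign l : C := if l is l'.+1 then (-1) ^+ l * word_sign l' else -1.

Lemma word_skew l a b : word l a b = word_sign l *: word l b a.
Proof.
elim: l a b => [|l IHl] a b; first by rewrite word0 /= scaleN1r -gen_mx_skew.
have -> : word l.+1 b a = word (0 + l).+1 b a by rewrite add0n.
rewrite word_catE wordS mulJmxE scaler_sumr exchange_big.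
apply: eq_bigr => d _ /=; rewrite scaler_sumr; apply: eq_bigr => c _ /=.
rewrite word0 (super_comm (word_extpow l a c) (gen_mx_extpow d b)) muln1 gen_mx_skew (IHl a c).
rewrite (JE JT) mulNr !scalerN scalerAr !scalerA !scaleNr opprK.
by rewrite -scalerAr scalerA mulrC.
Qed.

Lemma wtrace_extpow l : wtrace l \in extpow U l.+1.
Proof. by apply: memv_suml => a _; apply: memv_suml => b _; rewrite memvZ ?word_extpow. Qed.

Lemma eq_oppr0 (y : W) : y = - y -> y = 0.
Proof.
move/eqP; rewrite -addr_eq0 -mulr2n -scaler_nat scaler_eq0 pnatr_eq0 /=.
by move/eqP.
Qed.

Lemma wtrace_skew l : wtrace l = - word_sign l *: wtrace l.
Proof.
rewrite {1}/wtrace exchange_big scaler_sumr; apply: eq_bigr => b _.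
rewrite scaler_sumr; apply: eq_bigr => a _ /=.
by rewrite word_skew (JE JT) !scalerA mulrC mulNr mulrN.
Qed.

(** An even number of odd factors: moving the last factor X around the trace
    changes the sign. *)
Lemma wtrace_odd l : odd l -> wtrace l = 0.
Proof.
case: l => // l /= evl; apply: eq_oppr0; rewrite {1}/wtrace -sumrN.
rewrite [in RHS]sumrN.
under [LHS]eq_bigr do under eq_bigr do rewrite wordS mulJmxE scaler_sumr.
under [LHS]eq_bigr do rewrite exchange_big /=.
rewrite [LHS]exchange_big -sumrN; apply: eq_bigr => c _ /=.
under [LHS]eq_bigr do under eq_bigr do rewrite scaler_sumr.
under [LHS]eq_bigr do rewrite exchange_big /=.
rewrite [LHS]exchange_big -sumrN; apply: eq_bigr => d _ /=.
have -> : word l.+1 d c = word (0 + l).+1 d c by rewrite add0n.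
rewrite word_catE scaler_sumr -sumrN.
apply: eq_bigr => a _; rewrite scaler_sumr -sumrN; apply: eq_bigr => b _ /=.
rewrite word0 (super_comm (word_extpow l b c) (gen_mx_extpow d a)) muln1 exprS.
rewrite -signr_odd (negPf evl).
by rewrite expr0 mulr1 scaleN1r !scalerN !scalerA mulrC.
Qed.

Lemma word_act g l : g *m J *m g^T = J ->
  map_mx (ext_act g) (word l) = scalmx g^T *m word l *m scalmx g.
Proof.
move=> gJ; elim: l => [|l IHl]; first by rewrite word0 ext_act_gen_mx.
have [_ h0 h2] := extmap_morph (ext2_act g).
have actM (A B : 'M[W]_n) : map_mx (ext_act g) (A *m B) =
    map_mx (ext_act g) A *m map_mx (ext_act g) B.
  apply/matrixP => a b; rewrite [LHS]mxE [(A *m B) a b]mxE [RHS]mxE linear_sum.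
  by apply: eq_bigr => c _; rewrite [LHS]h2 !mxE.
rewrite wordS !actM IHl ext_act_gen_mx.
have -> : map_mx (ext_act g) (scalmx J) = scalmx J.
  by apply/matrixP => a b; rewrite !mxE linearZ /= [X in _ *: X]h0.
by apply: mulmx_sandwich; rewrite -!scalmxM gJ.
Qed.

Lemma wtrace_act g l : g *m J *m g^T = J -> ext_act g (wtrace l) = wtrace l.
Proof.
move=> gJ; rewrite /wtrace linear_sum.
have ZE a b : ext_act g (word l b a) = \sum_c \sum_d (g c b * g d a) *: word l c d.
  have /matrixP/(_ b a) := word_act l gJ; rewrite mxE mul_scalmx_r => ->.
  rewrite exchange_big; apply: eq_bigr => d _ /=.
  rewrite mul_scalmx_l scaler_sumr; apply: eq_bigr => c _.
  by rewrite !mxE scalerA mulrC.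
under eq_bigr do rewrite linear_sum.
under eq_bigr do under eq_bigr do rewrite linearZ /= ZE scaler_sumr.
under eq_bigr do rewrite exchange_big /=.
rewrite exchange_big /= [RHS]exchange_big; apply: eq_bigr => c _ /=.
under eq_bigr do under eq_bigr do rewrite scaler_sumr.
under eq_bigr do rewrite exchange_big /=.
rewrite exchange_big; apply: eq_bigr => d _ /=.
under eq_bigr do under eq_bigr do rewrite scalerA.
under eq_bigr do rewrite -scaler_suml.
rewrite -scaler_suml; congr (_ *: _).
have /matrixP/(_ d c) := gJ; rewrite -mulmxA !mxE => <-; apply: eq_bigr => a _.
rewrite !mxE mulr_sumr; apply: eq_bigr => b _.
by rewrite !mxE; ring.
Qed.
End Forms.

(** * Newton's identities and the Amitsur-Levitzki theorem *)

Section Newton.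
Variables (R : comNzRingType) (n' : nat).
Local Notation n := n'.+1.
Variable M : 'M[R]_n.
Hypothesis reg : forall m (x : R), x *+ m.+1 = 0 -> x = 0.
Hypothesis tr0 : forall j, \tr (M ^+ j.+1) = 0.

Let B := char_poly_mx M.
Let chi := char_poly M.

(** Jacobi's formula for the derivative of a determinant. *)
Lemma char_poly_deriv : chi^`() = \tr (\adj B).
Proof.
rewrite /chi /char_poly -/B /determinant deriv_sum.
have sgn_deriv (s : 'S_n) (p : {poly R}) : ((-1) ^+ s * p)^`() = (-1) ^+ s * p^`().
  by case: (odd_perm s); rewrite ?mulN1r ?mul1r ?derivN.
rewrite /mxtrace; under [RHS]eq_bigr do rewrite mxE expand_cofactor big_mkcond /=.
rewrite [RHS]exchange_big; apply: eq_bigr => s _ /=.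
rewrite sgn_deriv (eq_bigl [in [set: 'I_n]]); last by move=> i; rewrite in_setT.
rewrite deriv_prod mulr_sumr; apply: eq_big => [i|i _]; first by rewrite in_setT.
rewrite !mxE derivB derivC subr0 derivMn derivX.
rewrite eq_sym; case: eqP => _; last by rewrite mul0r mulr0.
rewrite mul1r; congr (_ * _); apply: eq_bigl => j.
by rewrite !inE andbT eq_sym.
Qed.

Lemma size_adj i j : (size (\adj B i j) <= n)%N.
Proof.
rewrite mxE expand_cofactor; apply: (leq_trans (size_sum _ _ _)).
apply/bigmax_leqP => s _.
have -> : size ((-1) ^+ s * \prod_(k | j != k) B k (s k)) =
    size (\prod_(k | j != k) B k (s k)).
  by case: (odd_perm s); rewrite ?mulN1r ?mul1r ?size_polyN.
apply: (leq_trans (size_prod_leq _ _)).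
have sB k : (size (B k (s k)) <= 2)%N.
  rewrite !mxE; apply: (leq_trans (size_polyD _ _)).
  rewrite size_polyN geq_max (leq_trans (size_polyC_leq1 _)) // andbT.
  by case: eqP => _; rewrite ?mulr1n ?mulr0n ?size_polyX ?size_poly0.
have c : #|[pred k | j != k]| = n'.
  have := cardC (pred1 j); rewrite card1 card_ord add1n => -[e].
  rewrite -[RHS]e; by apply: eq_card => k; rewrite !inE eq_sym.
have : (\sum_(k < n | j != k) size (B k (s k)) <= n' * 2)%N.
  apply: leq_trans (_ : #|[pred k | j != k]| * 2 <= _)%N; last by rewrite c.
  by rewrite -sum_nat_const; apply: leq_sum => k _; apply: sB.
rewrite c => le; rewrite leq_subLR; apply: leq_ltn_trans le _.
by rewrite muln2 -addnn addnS.
Qed.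

(** With the traces of the positive powers zero, Newton's identities take the
    form X^(n+1) chi' - n X^n chi = tr (adj (X - M) M^(n+1)). The right side has
    degree less than n, so X chi' = n chi and chi = X^n. *)
Lemma nilpotent_of_traces : M ^+ n = 0.
Proof.
pose Mp := map_mx polyC M.
have MpX j : Mp ^+ j = map_mx polyC (M ^+ j) by rewrite -rmorphXn.
have trMp j : \tr (Mp ^+ j) = (\tr (M ^+ j))%:P.
  by rewrite MpX /mxtrace rmorph_sum; apply: eq_bigr => i _; rewrite mxE.
have Bcomm : GRing.comm ('X%:M : 'M[{poly R}]_n) Mp.
  by rewrite /GRing.comm; apply: comm_scalar_mx.
have key : 'X^n * ('X * chi^`() - chi *+ n) = \tr (\adj B *m Mp ^+ n.+1).
  have geom := subrXX_comm n.+1 Bcomm.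
  have e : \tr (\adj B *m ('X%:M ^+ n.+1 - Mp ^+ n.+1)) = chi * ('X^n *+ n).
    rewrite geom -[_ * _]/(B *m _) mulmxA mul_adj_mx -/chi mul_scalar_mx mxtraceZ.
    congr (_ * _); rewrite raddf_sum big_ord_recl /= expr0 mulr1.
    rewrite -rmorphXn /= mxtrace_scalar subn0 big1 ?addr0 // => i _.
    by rewrite -rmorphXn /= -[_ * _]/(_ *m _) mul_scalar_mx mxtraceZ trMp tr0 mulr0.
  move: e; rewrite mulmxBr raddfB /= -rmorphXn /= mul_mx_scalar mxtraceZ.
  rewrite -char_poly_deriv => /eqP; rewrite subr_eq => /eqP e.
  by rewrite mulrBr mulrA -exprSr e !mulrnAr [chi * _]mulrC addrAC subrr add0r.
have sz : (size ('X^n * ('X * chi^`() - chi *+ n))%R <= n)%N.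
  rewrite key /mxtrace; apply: (leq_trans (size_sum _ _ _)).
  apply/bigmax_leqP => i _; rewrite mxE; apply: (leq_trans (size_sum _ _ _)).
  apply/bigmax_leqP => j _; rewrite MpX [map_mx _ _ _ _]mxE mulrC mul_polyC.
  exact: leq_trans (size_scale_leq _ _) (size_adj _ _).
have chiE j : (j < n)%N -> chi`_j = 0.
  move=> jn; have := nth_default 0 (leq_trans sz (leq_addr j n)).
  rewrite coefXnM ltnNge leq_addr addKn /= coefB coefMn coefXM coef_deriv.
  case: j jn => [|j] jn /=; rewrite ?sub0r.
    by move/eqP; rewrite oppr_eq0 => /eqP; apply: reg.
  move/eqP; rewrite -opprB oppr_eq0 -mulrnBr 1?ltnW // => /eqP.
  by case: (n - j.+1)%N (subn_gt0 j.+1 n) => [|d _]; [rewrite jn | apply: reg].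
have chiX : chi = 'X^n.
  apply/polyP => j; rewrite coefXn; case: ltngtP => [/chiE->//|jn|->].
    by rewrite nth_default // size_char_poly.
  by have /monicP := char_poly_monic M; rewrite /lead_coef size_char_poly.
by have := Cayley_Hamilton M; rewrite -/chi chiX rmorphXn /= horner_mx_X.
Qed.
End Newton.

Section Even.
Variables (F : fieldType) (U : vectType F).
Local Notation m := (\dim {:U}).
Local Notation E := (exterior U).

(** The even part of the exterior algebra, a commutative ring: this is where the
    theory of characteristic polynomials applies. *)
Definition evenp : {pred E} := fun x => [forall A : {set 'I_m}, odd #|A| ==> (x A == 0)].

Lemma evenpP (x : E) :
  reflect (forall A : {set 'I_m}, odd #|A| -> x A = 0) (x \in evenp).
Proof.
apply: (iffP forallP) => [h A oA|h A]; first by apply/eqP; have /implyP := h A; apply.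
by apply/implyP => /h ->.
Qed.

Lemma evenp_extpow d (x : E) : ~~ odd d -> x \in extpow U d -> x \in evenp.
Proof.
move=> evd /extpow_gbasis[c ->]; apply/evenpP => A oA.
rewrite sum_ffunE big1 // => S /eqP cS; rewrite !ffunE.
by case: eqP => [eA|_]; [rewrite eA cS (negPf evd) in oA | rewrite scaler0].
Qed.

Lemma evenpE (x : E) : x \in evenp ->
  x = \sum_(A : {set 'I_m} | ~~ odd #|A|) (x A : F) *: (gbasis F A : E).
Proof.
move/evenpP => ex; rewrite {1}[x]gbasisE (bigID (fun A : {set 'I_m} => odd #|A|)) /=.
by rewrite big1 ?add0r // => A /ex ->; rewrite scale0r.
Qed.

Fact evenp_closed : subring_closed evenp.
Proof.
split=> [|x y /evenpP ex /evenpP ey|x y ex ey].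
- by apply: (@evenp_extpow 0) => //; apply: one_extpow.
- by apply/evenpP => A oA; rewrite !ffunE ex // ey // subr0.
rewrite (evenpE ex) (evenpE ey) mulr_suml.
have sum_even (f : {set 'I_m} -> E) : (forall A : {set 'I_m}, ~~ odd #|A| -> f A \in evenp) ->
    \sum_(A : {set 'I_m} | ~~ odd #|A|) f A \in evenp.
  by move=> fe; apply/evenpP => D oD; rewrite sum_ffunE big1 // => A /fe/evenpP ->.
apply: (sum_even) => A eA; rewrite mulr_sumr; apply: sum_even => B eB.
rewrite -scalerAl -scalerAr scalerA; apply/evenpP => D oD; rewrite ffunE.
have eAB : ~~ odd (#|A| + #|B|) by rewrite oddD (negPf eA) (negPf eB).
have /evenpP h := evenp_extpow eAB (extpow_mul (gbasis_extpow A) (gbasis_extpow B)).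
by rewrite h // scaler0.
Qed.

HB.instance Definition _ := GRing.isSubringClosed.Build E evenp evenp_closed.

Record even_ext := EvenExt { even_val : E; _ : even_val \in evenp }.
HB.instance Definition _ := [isSub for even_val].
HB.instance Definition _ := [Choice of even_ext by <:].
HB.instance Definition _ := [SubChoice_isSubNzRing of even_ext by <:].

Fact even_mulC : commutative (@GRing.mul even_ext).
Proof.
move=> x y; apply: val_inj; rewrite !rmorphM /=.
have [ex ey] := (valP x, valP y).
rewrite (evenpE ex) (evenpE ey) mulr_suml mulr_sumr; apply: eq_bigr => A eA.
rewrite mulr_suml mulr_sumr; apply: eq_bigr => B eB.
rewrite -!scalerAl -!scalerAr scalerA [RHS]scalerA [X in X *: _]mulrC; congr (_ *: _).
rewrite (super_comm (gbasis_extpow A) (gbasis_extpow B)).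
by rewrite -signr_odd oddM (negPf eA) expr0 scale1r.
Qed.
HB.instance Definition _ := GRing.PzRing_hasCommutativeMul.Build even_ext even_mulC.
End Even.

Section Vanish.
Variables (C : numClosedFieldType) (n' : nat).
Local Notation n := n'.+1.
Local Notation U := (subvs_of (extpow 'cV[C]_n 2)).
Local Notation W := (exterior U).
Variable J : 'M[C]_n.
Hypothesis JJ : J *m J = - 1%:M.

Local Notation Y l := (scalmx J *m word J l).

Lemma Y_cat l l' : Y l *m Y l' = Y (l + l').+1.
Proof. by rewrite -word_cat; move: (word J l) (word J l') (scalmx J) => A B D; rewrite !mulmxA. Qed.

Lemma mxtrace_word l : \tr (Y l) = wtrace J l.
Proof. by apply: eq_bigr => a _; rewrite mul_scalmx_l. Qed.

Lemma Y_even l a b : odd l -> Y l a b \in @evenp C U.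
Proof.
move=> ol; apply: (@evenp_extpow _ _ l.+1); first by rewrite /= ol.
by rewrite mul_scalmx_l; apply: memv_suml => c _; rewrite memvZ ?word_extpow.
Qed.

(** The Amitsur-Levitzki theorem for J X, by Rosset's argument: (J X)^2 has
    entries in a commutative ring, and all its powers have trace zero by
    [wtrace_odd], so its n-th power vanishes. *)
Lemma word_eq0 : word J (n'.*2.+1) = 0.
Proof.
pose M : 'M[even_ext U]_n := \matrix_(a, b) EvenExt (@Y_even 1 a b isT).
have M1 : map_mx val M = Y 1.
  by apply/matrixP => a b; rewrite [LHS]mxE [M a b]mxE.
have ME j : map_mx val (M ^+ j.+1) = Y (j.*2.+1).
  elim: j => [|j IHj]; first by rewrite expr1.
  have -> : map_mx val (M ^+ j.+2) = map_mx val M *m map_mx val (M ^+ j.+1).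
    by rewrite exprS; apply: map_mxM.
  by rewrite M1 IHj; apply: (Y_cat 1 j.*2.+1).
have reg m (x : even_ext U) : x *+ m.+1 = 0 -> x = 0.
  move/(congr1 val); rewrite rmorphMn /= => /eqP.
  rewrite -scaler_nat scaler_eq0 pnatr_eq0 /= => /eqP x0.
  by apply: val_inj; rewrite /= x0.
have tr0 j : \tr (M ^+ j.+1) = 0.
  have t0 : wtrace J j.*2.+1 = 0 by apply: wtrace_odd; rewrite /= odd_double.
  apply: val_inj; rewrite rmorph0 -t0 -mxtrace_word -ME /mxtrace rmorph_sum.
  by apply: eq_bigr => i _; rewrite [RHS]mxE.
have := ME n'; rewrite (nilpotent_of_traces reg tr0).
move=> Y0; have Y0' : Y (n'.*2.+1) = 0 by rewrite -Y0; apply/matrixP => a b; rewrite !mxE.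
have : scalmx J *m Y (n'.*2.+1) = 0 by rewrite Y0' mulmx0.
rewrite mulmxA -scalmxM JJ => e; apply/matrixP => a b.
have : (scalmx (- 1%:M) *m word J n'.*2.+1) a b = 0 by rewrite e mxE.
rewrite [in X in _ -> X]mxE mul_scalmx_l (bigD1 a) //= big1 ?addr0 => [|c ne].
  by rewrite !mxE eqxx scaleN1r => /eqP; rewrite oppr_eq0 => /eqP.
by rewrite !mxE eq_sym (negPf ne) oppr0 scale0r.
Qed.

Lemma wtrace_large l : (n'.*2.+1 <= l)%N -> wtrace J l = 0.
Proof.
rewrite leq_eqVlt => le; suff word0 : word J l = 0.
  by apply: big1 => a _; apply: big1 => b _; rewrite word0 mxE scaler0.
case/predU1P: le => [<-|lt]; first exact: word_eq0.
rewrite -(subnKC lt) addSn -word_cat word_eq0.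
by move: (word _ _) (scalmx J) => A B; rewrite !mul0mx.
Qed.
End Vanish.

(** * The algebra generated by the traces *)

Section TraceAlgebra.
Variables (C : numClosedFieldType) (k : nat).
Hypothesis k_gt0 : (0 < k)%N.
Local Notation n := (k + k)%N.
Local Notation I := 'I_n.
Local Notation U := (subvs_of (extpow 'cV[C]_n 2)).
Local Notation W := (exterior U).
Variable J : 'M[C]_n.
Hypotheses (JT : J^T = - J) (JJ : J *m J = - 1%:M).
Implicit Types (L : {set 'I_k}) (l : nat).

Definition gen (i : 'I_k) : W := wtrace J (4 * i).
Definition mono L : W := \prod_(i in L) gen i.
Definition weight L : nat := \sum_(i in L) (4 * i).+1.
Definition trace_alg d : {vspace W} := (\sum_(L | weight L == d) <[mono L]>)%VS.

Lemma wtrace_anti l l' : ~~ odd l -> ~~ odd l' ->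
  wtrace J l * wtrace J l' = - (wtrace J l' * wtrace J l).
Proof.
move=> ol ol'; rewrite (super_comm (wtrace_extpow J l) (wtrace_extpow J l')).
by rewrite -signr_odd oddM /= ol ol' expr1 scaleN1r.
Qed.

Lemma gen_anti i j : gen i * gen j = - (gen j * gen i).
Proof. by apply: wtrace_anti; rewrite oddM. Qed.

Lemma gen_sq i : gen i * gen i = 0.
Proof. by apply/eq_oppr0/gen_anti. Qed.

Lemma monoM L L' : mono L * mono L' = wsign C L L' *: mono (L :|: L').
Proof. exact: prod_prod gen_sq gen_anti L L'. Qed.

Lemma word_sign4 l : word_sign C (l + 4) = word_sign C l.
Proof.
have wordS j : word_sign C j.+1 = (-1) ^+ j.+1 * word_sign C j by [].
have e2 : (-1) ^+ l * (-1) ^+ l = 1 :> C by rewrite -expr2 sqrr_sign.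
rewrite !addnS addn0 4!wordS !exprS; move: ((-1) ^+ l) (word_sign C l) e2 => e z e2.
transitivity (e * e * (e * e) * z); first by ring.
by rewrite e2 !mul1r.
Qed.

(** Lengths [l + 1] other than 1 modulo 4 are excluded by [wtrace_odd] and
    [wtrace_skew], lengths above 4k by [wtrace_large]. *)
Lemma wtrace_gen l : wtrace J l = 0 \/ exists i : 'I_k, l = (4 * i)%N.
Proof.
have [lk|kl] := ltnP l (4 * k); last first.
  left; have [k' ek] : exists k', k = k'.+1 by exists k.-1; rewrite prednK.
  move: J JJ kl; rewrite ek => J' JJ' kl.
  by apply: (wtrace_large (n' := (k' + k'.+1)%N) JJ'); lia.
have [q [r [el lt_r]]] : exists q r, l = (r + q * 4)%N /\ (r < 4)%N.
  by exists (l %/ 4)%N, (l %% 4)%N; rewrite ltn_mod addnC -divn_eq.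
have sgn : word_sign C l = word_sign C r.
  by rewrite el; elim: (q) => [|s IHs]; rewrite ?addn0 // mulSn addnCA addnC word_sign4.
case: r el lt_r sgn => [|[|[|[|//]]]] el _ sgn.
- by right; have qk : (q < k)%N by [lia]; exists (Ordinal qk); rewrite /=; lia.
- by left; apply: wtrace_odd; lia.
- left; apply: eq_oppr0; rewrite {1}(wtrace_skew JT) sgn /=.
  by rewrite expr1 sqrrN expr1n !mul1r mulrNN mulr1 scaleN1r.
- by left; apply: wtrace_odd; lia.
Qed.

Lemma mono_trace_alg L : mono L \in trace_alg (weight L).
Proof. by apply: (subvP (sumv_sup L _ (subvv _))) => //; apply: memv_line. Qed.

Lemma trace_alg_mul l (d : nat) y :
  y \in trace_alg d -> wtrace J l * y \in trace_alg (l.+1 + d)%N.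
Proof.
case: (wtrace_gen l) => [->|[i ->]] yA; first by rewrite mul0r mem0v.
have /memv_sumP[f fP ->] := yA.
rewrite mulr_sumr memv_suml // => L /eqP Ld; have /vlineP[c ->] := fP L (introT eqP Ld).
rewrite -scalerAr memvZ //.
rewrite [_ * _](mulv_prod gen_sq gen_anti); rewrite /wsign disjoints1.
case: ifPn => iL; last by rewrite scale0r mem0v.
rewrite memvZ //; have <- : weight (i |: L) = ((4 * i).+1 + d)%N.
  by rewrite /weight big_setU1 //= -Ld.
exact: mono_trace_alg.
Qed.

Lemma mono_extpow L : mono L \in extpow U (weight L).
Proof.
rewrite /mono /weight; elim/big_rec2: _ => [|i d y _ yd]; first exact: one_extpow.
by rewrite extpow_mul ?wtrace_extpow.
Qed.

Section Chains.
Variable P : finType.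
Local Notation Idx := {ffun P -> I}.
Local Notation Tens := {ffun Idx -> C^o}.
(** A chain [(l, p, q)] stands for the matrix entry of [word l] in the row and
    column given by the slots [p] and [q]. *)
Local Notation chain := (nat * P * P)%type.
Implicit Types (ch : chain) (cs : seq chain) (i j : Idx) (p q : P).

Definition entry ch i : W := word J ch.1.1 (i ch.1.2) (i ch.2).
Definition chains cs i : W := \prod_(ch <- cs) entry ch i.
Definition slots cs : seq P := flatten [seq [:: ch.1.2; ch.2] | ch <- cs].
Definition degree cs : nat := sumn [seq ch.1.1.+1 | ch <- cs].

Lemma chains_cons ch cs i : chains (ch :: cs) i = entry ch i * chains cs i.
Proof. by rewrite /chains big_cons. Qed.

Lemma degree_cons ch cs : degree (ch :: cs) = (ch.1.1.+1 + degree cs)%N.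
Proof. by []. Qed.

Lemma entry_depends ch i j : i ch.1.2 = j ch.1.2 -> i ch.2 = j ch.2 ->
  entry ch i = entry ch j.
Proof. by rewrite /entry => -> ->. Qed.

Lemma chains_depends cs i j : {in slots cs, i =1 j} -> chains cs i = chains cs j.
Proof.
elim: cs => [|ch cs IHcs] e; first by rewrite /chains !big_nil.
rewrite !chains_cons (@entry_depends _ i j) ?e ?inE ?eqxx ?orbT // IHcs //.
by move=> p pcs; apply: e; rewrite !inE pcs !orbT.
Qed.

Lemma entry_flip l p q i : entry (l, p, q) i = word_sign C l *: entry (l, q, p) i.
Proof. exact: word_skew. Qed.

Lemma entryC ch ch' i : entry ch i * entry ch' i =
  (-1) ^+ (ch.1.1.+1 * ch'.1.1.+1) *: (entry ch' i * entry ch i).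
Proof. exact: super_comm (word_extpow _ _ _ _) (word_extpow _ _ _ _). Qed.

(** A chain through a given slot can be moved to the front and turned so as to
    end there. The sign [c] depends on the chains only, not on the indices, so
    that it can be taken out of the sums over all indices. *)
Lemma chains_front p cs : p \in slots cs -> exists (c : C) l a cs',
  [/\ perm_eq (slots cs) [:: a, p & slots cs'], degree cs = (l.+1 + degree cs')%N,
      size cs = (size cs').+1
    & forall i, chains cs i = c *: chains ((l, a, p) :: cs') i].
Proof.
elim: cs => [//|[[l a] b] cs IHcs]; rewrite !inE => /or3P[/eqP->|/eqP->|].
- exists (word_sign C l), l, b, cs; split=> // [|i].
    exact: permEl (perm_catCA [:: a] [:: b] (slots cs)).
  by rewrite !chains_cons entry_flip scalerAl.
- by exists 1, l, a, cs; split=> // i; rewrite scale1r.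
move=> /IHcs[c [l' [a' [cs' [pe de se ce]]]]].
exists ((-1) ^+ (l.+1 * l'.+1) * c), l', a', ((l, a, b) :: cs'); split=> [||/=|i].
- apply: (@perm_trans _ ([:: a; b] ++ [:: a'; p] ++ slots cs')).
    by rewrite /= !perm_cons.
  exact: permEl (perm_catCA [:: a; b] [:: a'; p] (slots cs')).
- by rewrite !degree_cons de addnCA.
- by rewrite se.
rewrite chains_cons ce !chains_cons -scalerAr [in LHS]mulrA [in LHS]entryC /= -scalerAl !scalerA.
by congr (_ *: _); [apply: mulrC | rewrite mulrA].
Qed.

Lemma memv_mulrn (T : vectType C) (A : {vspace T}) (x : T) m :
  (0 < m)%N -> x *+ m \in A -> x \in A.
Proof.
move=> m0; rewrite -scaler_nat => h.
rewrite -[x]scale1r -(@mulVf _ (m%:R : C)); first by rewrite -scalerA memvZ.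
by rewrite pnatr_eq0 -lt0n.
Qed.

Lemma sum_upd2 (T : zmodType) (G : Idx -> T) p q :
  (\sum_i G i) *+ (n * n) = \sum_i \sum_b \sum_c G (upd (upd i p b) q c).
Proof. by rewrite mulrnA -(sum_upd G q) -(sum_upd (fun i => \sum_c G (upd i q c)) p). Qed.

(** Contraction with J of the two ends of a chain closes it into a trace, and
    contraction of the ends of two chains joins them. By induction on the
    matching, the chains are used up and only traces remain. *)
Lemma matchings_chains m (S : {set P}) cs (f : Tens) :
  uniq (slots cs) -> slots cs =i S -> size cs = m -> f \in matchings J m S ->
  \sum_i (f i : C) *: chains cs i \in trace_alg (degree cs).
Proof.
have n2 : (0 < n * n)%N by rewrite muln_gt0 addn_gt0 k_gt0.
elim: m S cs f => [|m IHm] S cs f.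
  move=> _ _ /size0nil-> /vlineP[c ->].
  apply: memv_suml => i _; rewrite memvZ // /chains big_nil.
  have := mono_trace_alg set0; rewrite /mono /weight !big_set0.
  by [].
move=> ucs ecs scs; move: f; apply: matchings_ind.
- by rewrite big1 ?mem0v // => i _; rewrite ffunE scale0r.
- move=> f g fA gA; under eq_bigr do rewrite ffunE scalerDl.
  by rewrite big_split memvD.
move=> p q f pS qS ne fM.
have [c [l [a [cs1 [pe de se ce]]]]] : exists (c : C) l a cs',
  [/\ perm_eq (slots cs) [:: a, p & slots cs'], degree cs = (l.+1 + degree cs')%N,
      size cs = (size cs').+1
    & forall i, chains cs i = c *: chains ((l, a, p) :: cs') i].
  by apply: chains_front; rewrite ecs.
have fD : depends (S :\ p :\ q) f := matchings_depends fM.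
have fU i b d : f (upd (upd i p b) q d) = f i.
  by apply: fD => r; rewrite !inE => /and3P[rq rp _]; rewrite !updN.
have := ucs; rewrite (perm_uniq pe) /= inE negb_or => /and3P[/andP[nap na1] np1 u1].
have e1 r : (r \in S) = (r \in [:: a, p & slots cs1]) by rewrite -ecs (perm_mem pe).
(* summing over the indices at p and q first counts each index n * n times *)
rewrite de; apply: (memv_mulrn n2); rewrite (sum_upd2 _ p q).
have -> : \sum_i \sum_b \sum_d
    ((mulJ J p q f (upd (upd i p b) q d) : C) *: chains cs (upd (upd i p b) q d)) =
  c *: \sum_i f i *: \sum_b \sum_d J b d *:
     chains ((l, a, p) :: cs1) (upd (upd i p b) q d).
  rewrite scaler_sumr; apply: eq_bigr => i _.
  rewrite scalerA scaler_sumr; apply: eq_bigr => b _.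
  rewrite scaler_sumr; apply: eq_bigr => d _.
  rewrite mulJE fU ce updN 1?eq_sym // !updE !scalerA; congr (_ *: _).
  by rewrite mulrC mulrAC mulrA.
rewrite memvZ //; have := qS; rewrite e1 !inE (negPf ne) /= => /orP[/eqP qa|q1].
  (* the chain is closed into a trace *)
  have -> : \sum_i f i *: (\sum_b \sum_d J b d *:
      chains ((l, a, p) :: cs1) (upd (upd i p b) q d)) =
      wtrace J l * \sum_i f i *: chains cs1 i.
    rewrite mulr_sumr; apply: eq_bigr => i _; rewrite -scalerAr; congr (_ *: _).
    rewrite /wtrace mulr_suml; apply: eq_bigr => b _; rewrite mulr_suml.
    apply: eq_bigr => d _; rewrite -scalerAl; congr (_ *: _).
    rewrite chains_cons /entry /= -qa updE updN 1?eq_sym // updE; congr (_ * _).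
    apply: chains_depends => r r1; rewrite !updN //.
      by apply: contraNneq np1 => <-.
    by rewrite qa; apply: contraNneq na1 => <-.
  apply: trace_alg_mul; apply: (IHm (S :\ p :\ q)) => //.
    move=> r; rewrite !inE e1 !inE -qa.
    have [->|rq] := eqVneq r q; first by rewrite qa (negPf na1).
    have [->|rp] := eqVneq r p; first by rewrite (negPf np1).
    by [].
  by move: scs; rewrite se => -[].
(* two chains are joined *)
have [c' [l' [b' [cs2 [pe2 de2 se2 ce2]]]]] := chains_front q1.
have := u1; rewrite (perm_uniq pe2) /= inE negb_or => /and3P[/andP[nbq nb2] nq2 u2].
have e2 r : (r \in slots cs1) = (r \in [:: b', q & slots cs2]) by rewrite (perm_mem pe2).
have [pb pq p2] : [/\ p != b', p != q & p \notin slots cs2].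
  by move: np1; rewrite e2 !inE !negb_or => /and3P[].
have [ab aq a2] : [/\ a != b', a != q & a \notin slots cs2].
  by move: na1; rewrite e2 !inE !negb_or => /and3P[].
have -> : \sum_i f i *: (\sum_b \sum_d J b d *:
    chains ((l, a, p) :: cs1) (upd (upd i p b) q d)) =
    (c' * word_sign C l') *: \sum_i f i *: chains (((l + l').+1, a, b') :: cs2) i.
  rewrite scaler_sumr; apply: eq_bigr => i _; rewrite [RHS]scalerA mulrC -scalerA.
  congr (_ *: _); rewrite [in RHS]chains_cons /entry /= word_catE mulr_suml.
  rewrite scaler_sumr; apply: eq_bigr => b _; rewrite mulr_suml.
  rewrite scaler_sumr; apply: eq_bigr => d _.
  rewrite chains_cons ce2 chains_cons [entry (l', b', q) _]entry_flip /entry /=.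

  rewrite -[in RHS]scalerAl [RHS]scalerA [_ * J b d]mulrC -scalerA; congr (_ *: _).
  rewrite -!scalerAl -!scalerAr !scalerA -mulrA; congr (_ *: _).
  rewrite !updE !(updN _ _ aq, updN _ _ nap, updN _ _ pq) // updE.
  rewrite (updN _ _ nbq) (updN _ _ (_ : b' != p)) 1?eq_sym //; congr (_ * (_ * _)).
  apply: chains_depends => r r2; rewrite !updN //.
    by apply: contraNneq p2 => <-.
  by apply: contraNneq nq2 => <-.
rewrite memvZ // (_ : (l.+1 + degree cs1)%N = degree (((l + l').+1, a, b') :: cs2)).
  apply: (IHm (S :\ p :\ q)) => //.
  - by rewrite /= inE negb_or ab a2 nb2.
  - move=> r; rewrite !inE e1 !inE e2 !inE.
    have [->|rq] := eqVneq r q.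
      by rewrite (negPf nq2) eq_sym (negPf aq) eq_sym (negPf nbq).
    have [->|rp] := eqVneq r p.
      by rewrite (negPf p2) eq_sym (negPf nap) (negPf pb).
    by [].
  by move: scs; rewrite se se2 => -[].
by rewrite de2 degree_cons /= addnA addSn addnS.
Qed.
End Chains.
End TraceAlgebra.

(** * The invariants of the symplectic group *)

Section DimSum.
Variables (F : fieldType) (V : vectType F) (T : finType).

Lemma dim_sum_lines (P : pred T) (v : T -> V) :
  (forall c : T -> F, \sum_(i | P i) c i *: v i = 0 -> forall i, P i -> c i = 0) ->
  \dim (\sum_(i | P i) <[v i]>)%VS = #|P|.
Proof.
move=> free_v.
have nz i : P i -> v i != 0.
  move=> Pi; apply/eqP => v0.
  have := free_v (fun j => (j == i)%:R); rewrite (bigD1 i) //= v0 scaler0 add0r.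
  rewrite big1 => [|j /andP[_ /negPf->]]; last by rewrite scale0r.
  by move=> /(_ erefl i Pi)/eqP; rewrite eqxx oner_eq0.
have /directvP/= -> : directv (\sum_(i | P i) <[v i]>)%VS.
  apply/directv_sum_independent => u uP u0 i Pi.
  have uE j : P j -> u j = coord [tuple v j] ord0 (u j) *: v j.
    move=> Pj; have /vlineP[a ->] := uP j Pj.
    by rewrite linearZ /= (coord_free ord0 ord0) ?seq1_free ?nz // mulr1.
  rewrite uE // (free_v (fun j => coord [tuple v j] ord0 (u j))) ?scale0r //.
  by rewrite -[RHS]u0; apply: eq_bigr => j /uE.
rewrite (eq_bigr (fun=> 1%N)) ?sum1_card // => i Pi.
by rewrite dim_vline nz.
Qed.
End DimSum.

Lemma dim_extpow (F : fieldType) (U : vectType F) d :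
  \dim (extpow U d) = 'C(\dim {:U}, d).
Proof.
rewrite extpowE dim_sum_lines => [|c c0 S Sd].
  by rewrite -[m in 'C(m, _)]card_ord -card_draws cardsE.
have /ffunP/(_ S) := c0; rewrite sum_ffunE (bigD1 S) //= !ffunE eqxx.
rewrite big1 ?addr0 => [|T /andP[_ /negPf ne]].
  by rewrite /GRing.scale /= mulr1.
by rewrite !ffunE eq_sym ne scaler0.
Qed.

Section Main.
Variables (C : numClosedFieldType) (k : nat).
Hypothesis k_gt0 : (0 < k)%N.
Local Notation n := (k + k)%N.
Local Notation I := 'I_n.
Local Notation V := 'cV[C]_n.
Local Notation U := (subvs_of (extpow V 2)).
Local Notation W := (exterior U).
Local Notation J := (symplectic_form C k).
Implicit Types (L : {set 'I_k}) (g : 'M[C]_n).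

Lemma symplectic_form_skew : J^T = - J.
Proof.
by rewrite /symplectic_form tr_block_mx !trmx0 trmx1 linearN /= trmx1 opp_block_mx !oppr0 opprK.
Qed.

Lemma symplectic_form_sqr : J *m J = - 1%:M.
Proof.
rewrite /symplectic_form mulmx_block !(mulmx0, mul0mx, mulmx1, mul1mx, add0r, addr0).
by rewrite (@scalar_mx_block C k k 1) opp_block_mx !oppr0.
Qed.

Lemma symplectic_inv g : g^T *m J *m g = J -> (- (J *m g^T *m J)) *m g = 1%:M.
Proof.
move=> gJ; rewrite mulNmx -!mulmxA [g^T *m _]mulmxA gJ.
by rewrite symplectic_form_sqr opprK.
Qed.

Lemma transvection_Sp (u : V) t : Sp C k (1%:M + t *: (u *m u^T *m J)).
Proof.
set g := _ + _; suff gJ : g^T *m J *m g = J.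
  by split=> //; have [_] := mulmx1_unit (symplectic_inv gJ).
have uJu := skew_form_self u symplectic_form_skew.
have gT : g^T = 1%:M - t *: (J *m u *m u^T).
  rewrite /g linearD linearZ /= trmx1 !trmx_mul trmxK symplectic_form_skew mulNmx scalerN.
  by rewrite mulmxA.
rewrite gT mulmxBl mul1mx mulmxBl !mulmxDr !mulmx1.
rewrite -!scalemxAl -!scalemxAr -!mulmxA.
have -> : u^T *m (J *m (u *m (u^T *m J))) = 0.
  by rewrite !mulmxA uJu !mul0mx.
by rewrite !mulmx0 !scaler0 addr0 addrK.
Qed.

Lemma Sp_tr g : Sp C k g -> g *m J *m g^T = J.
Proof.
case=> _ /symplectic_inv/mulmx1C; rewrite mulmxN !mulmxA => /(congr1 (mulmx^~ J)) /=.
by rewrite mulNmx -(mulmxA (g *m J *m g^T)) symplectic_form_sqr mulmxN mulmx1 opprK mul1mx.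
Qed.

Section Tensor.
Variable d : nat.
Local Notation P := ('I_d * bool)%type.
Local Notation Idx := {ffun P -> I}.
Local Notation Tens := {ffun Idx -> C^o}.

Definition pairs_of (i : Idx) : d.-tuple (I * I) :=
  [tuple (i (r, false), i (r, true)) | r < d].
Definition of_pairs (t : d.-tuple (I * I)) : Idx :=
  [ffun p : P => if p.2 then (tnth t p.1).2 else (tnth t p.1).1].

Lemma pairs_ofK : cancel pairs_of of_pairs.
Proof. by move=> i; apply/ffunP => -[r []]; rewrite ffunE /= tnth_mktuple. Qed.

Lemma of_pairsK : cancel of_pairs pairs_of.
Proof.
move=> t; apply: eq_from_tnth => r; rewrite tnth_mktuple !ffunE /=.
by case: (tnth t r).
Qed.

Lemma sum_pairs (T : nmodType) (G : d.-tuple (I * I) -> T) :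
  \sum_t G t = \sum_i G (pairs_of i).
Proof. by apply: reindex; exists of_pairs => i _; [apply: pairs_ofK | apply: of_pairsK]. Qed.

(** The equivariant lift of an element of degree d to a tensor with 2d slots,
    two for each factor e_a /\ e_b. *)
Definition tensor_of (x : W) : Tens := [ffun i => iter_iprod (@coord2 C n) (pairs_of i) x].

Lemma act_tensor g x i : diag_act g (tensor_of x) i = tensor_of (ext_act g x) i.
Proof.
rewrite [RHS]ffunE (iter_iprod_extmap (@coord2_lin C n) (coord2_act g)) sum_pairs.
apply: eq_bigr => j _; rewrite ffunE; congr (_ * _).
transitivity (\prod_r \prod_b g (i (r, b)) (j (r, b))).
  by rewrite pair_bigA; apply: eq_bigr => -[].
by apply: eq_bigr => r _; rewrite big_bool !tnth_mktuple mulrC.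
Qed.

Definition initial_chains : seq (nat * P * P) :=
  [seq (0%N, (r, false), (r, true)) | r <- enum 'I_d].

Lemma slots_initial_chains :
  slots initial_chains = [seq (r, b) | r <- enum 'I_d, b <- [:: false; true]].
Proof. by rewrite /slots /initial_chains -map_comp. Qed.

(** The lift of [x] is an invariant tensor, hence a combination of matchings.
    Mapping it back to the exterior algebra evaluates the matchings on [d] chains
    of length one, and returns a nonzero multiple of [x]. *)
Lemma semi_inv_trace_alg (x : W) : x \in extpow U d ->
  (forall (u : V) t, exists z, ext_act (1%:M + t *: (u *m u^T *m J)) x = z *: x) ->
  x \in trace_alg J d.
Proof.
move=> xd semi.
have fM : tensor_of x \in matchings J d setT.
  apply: symplectic_fft; rewrite ?symplectic_form_skew ?symplectic_form_sqr //.
  - by rewrite cardsT card_prod card_ord card_bool muln2.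
  - by move=> i j e; congr (tensor_of x _); apply/ffunP => p; apply: e.
  apply: semi_inv_lie_inv; first exact: symplectic_form_skew.
  move=> u t; have [z zE] := semi u t; exists z => i.
  by rewrite act_tensor zE !ffunE iter_iprod_scale //; apply: coord2_lin.
have := @matchings_chains _ _ k_gt0 _ symplectic_form_skew symplectic_form_sqr
  _ _ _ initial_chains _ _ _ _ fM.
have -> : degree initial_chains = d.
  by rewrite /degree /initial_chains -map_comp sumnE big_map sum1_size size_enum_ord.
have -> : \sum_i (tensor_of x i : C) *: chains J initial_chains i = (2 ^+ d *+ d`!) *: x.
  rewrite -(iter_iprod_euler (@coord2_lin C n) (@coord2_sum C n) xd) sum_pairs.
  apply: eq_bigr => i _; rewrite ffunE; congr (_ *: _).
  rewrite /chains /initial_chains !big_map -enumT; apply: eq_bigr => r _.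
  by rewrite /entry word0 mxE.
move=> h; rewrite -[x]scale1r -(@mulVf _ (2 ^+ d *+ d`! : C)).
  rewrite -scalerA memvZ // h //.
  - by rewrite slots_initial_chains allpairs_uniq ?enum_uniq // => -[r b] [r' b'].
  - move=> [r b]; rewrite in_setT slots_initial_chains; apply/allpairsP.
    by exists (r, b); rewrite /= mem_enum; case: b.
  - by rewrite size_map size_enum_ord.
by rewrite mulrn_eq0 -leqn0 leqNgt fact_gt0 expf_eq0 pnatr_eq0 andbF.
Qed.
End Tensor.
End Main.

Section Dims.
Variables (C : numClosedFieldType) (k : nat).
Hypothesis k_gt0 : (0 < k)%N.
Local Notation n := (k + k)%N.
Local Notation V := 'cV[C]_n.
Local Notation U := (subvs_of (extpow V 2)).
Local Notation W := (exterior U).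
Local Notation J := (symplectic_form C k).
Local Notation mono := (mono J).
Implicit Types (L : {set 'I_k}) (g : 'M[C]_n).

Lemma mono_act g L : Sp C k g -> ext_act g (mono L) = mono L.
Proof.
move=> /Sp_tr gJ; have [_ h0 h2] := extmap_morph (ext2_act g).
rewrite /mono; elim/big_rec: _ => [|i y _ IHy]; first exact: h0.
by rewrite [LHS]h2 IHy [X in X * _](wtrace_act _ gJ).
Qed.

Lemma invariants_trace_alg d :
  (extpow U d :&: invariants (fun g => ext_act g) (Sp C k))%VS = trace_alg J d.
Proof.
apply/vspaceP => x; apply/idP/idP.
  rewrite memv_cap => /andP[xd /invariantsP xI]; apply: semi_inv_trace_alg => // u t.
  by exists 1; rewrite scale1r; apply/xI/transvection_Sp.
move: x; apply/subvP/subv_sumP => L /eqP <-; rewrite -memvE memv_cap mono_extpow.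
by apply/invariantsP => g; apply: mono_act.
Qed.

(** Both sides are k (2k - 1). *)
Lemma weightT : weight [set: 'I_k] = \dim {:U}.
Proof.
have -> : \dim {:U} = 'C(n, 2).
  have dV : \dim {:V} = n by rewrite dimvf /dim /= muln1.
  transitivity 'C(\dim {:V}, 2); last by rewrite dV.
  by rewrite -dim_extpow; apply: dimvf.
rewrite bin2 /weight; elim: (k) => [|j IHj]; first by rewrite big_pred0 // => -[].
under eq_bigl do rewrite in_setT; rewrite big_ord_recr /=.
move: IHj; under eq_bigl do rewrite in_setT; move=> ->.
by nia.
Qed.

Lemma weight_inj_sub L L' : L \subset L' -> weight L = weight L' -> L = L'.
Proof.
move=> sub e; apply/eqP; rewrite eqEsubset sub; apply: contraT => /subsetPn[i iL' iL].
have : (weight (i |: L) <= weight L')%N.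
  rewrite /weight [X in (_ <= X)%N](big_setID (i |: L)) /=.
  rewrite (setIidPr _) ?leq_addr //.
  by apply/subsetP => j /setU1P[->|/(subsetP sub)].
by rewrite -e /weight big_setU1 //= addSn ltnNge leq_addl.
Qed.

(** The top exterior power is a semi-invariant line, so it consists of traces.
    The only product of generators of that degree is the full one. *)
Lemma monoT_neq0 : mono setT != 0.
Proof.
pose top : W := gbasis C setT.
have topN : top \in extpow U (\dim {:U}).
  by have := @gbasis_extpow _ U setT; rewrite cardsT card_ord.
have line x : x \in extpow U (\dim {:U}) -> exists z, x = z *: top.
  move/extpow_gbasis=> [c ->]; exists (c setT); rewrite (big_pred1 setT) // => S.
  have le : (#|S| <= \dim {:U})%N by rewrite -[X in (_ <= X)%N]card_ord max_card.
  by rewrite /= eqn_leq le eqEcard subsetT cardsT card_ord.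
have : top \in trace_alg J (\dim {:U}).
  apply: semi_inv_trace_alg => // u t; apply: line; exact: extmap_extpow.
rewrite /trace_alg (big_pred1 setT) => [/vlineP[z topE]|L].
  apply/eqP => m0; move: topE; rewrite m0 scaler0 => /ffunP/(_ setT)/eqP.
  by rewrite !ffunE eqxx oner_eq0.
rewrite -weightT; apply/eqP/eqP => [|->//]; apply: weight_inj_sub; exact: subsetT.
Qed.

(** In a relation between products of the same degree, multiplication by the
    product complementary to [L] kills all terms but that of [L]: a set disjoint
    from the complement is contained in [L], and equal to it by degree. *)
Lemma dim_trace_alg d : \dim (trace_alg J d) = #|[pred L : {set 'I_k} | weight L == d]|.
Proof.
apply: dim_sum_lines => c c0 L /eqP Ld.
have : (\sum_(L' : {set 'I_k} | weight L' == d) c L' *: mono L') * mono (~: L) = 0.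
  by rewrite c0 mul0r.
rewrite mulr_suml (bigD1 L) ?Ld //= [X in _ + X]big1 ?addr0; last first.
  move=> L' /andP[/eqP L'd ne]; rewrite -scalerAl monoM.
  rewrite /wsign; case: ifPn => [dis|]; last by rewrite scale0r scaler0.
  case/eqP: ne; apply: weight_inj_sub; last by rewrite Ld.
  by move: dis; rewrite disjoints_subset setCK.
rewrite -scalerAl monoM.
rewrite /wsign -setI_eq0 setICr eqxx setUCr scalerA => /eqP.
by rewrite scaler_eq0 (negPf monoT_neq0) orbF mulf_eq0 signr_eq0 orbF => /eqP.
Qed.

Theorem hilbert_Sp :
  hilbert_ext_inv (@ext2_act C n) (Sp C k) = \prod_(i < k) (1 + 'X^((4 * i).+1)) :> {poly int}.
Proof.
transitivity (\sum_(L : {set 'I_k}) 'X^(weight L) : {poly int}).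
  apply/polyP => d; rewrite coef_hilbert_ext_inv.
  have -> : (extpow U d :&: invariants (fun g => extmap (ext2_act g)) (Sp C k))%VS
     = trace_alg J d by apply: invariants_trace_alg.
  rewrite dim_trace_alg coef_sum; under eq_bigr do rewrite coefXn.
  rewrite -sum1_card natr_sum big_mkcond; apply: eq_bigr => L _ /=.
  by rewrite inE eq_sym; case: eqP.
under [RHS]eq_bigr do rewrite addrC.
rewrite bigA_distr; apply: eq_bigr => L _; rewrite -big_mkcond /=.
exact: (big_morph (fun m => 'X^m) (exprD 'X) (expr0 'X)).
Qed.
End Dims.

(** * The q-binomial expansion of the Hilbert series *)

Section Gaussian.
Variables (R : comNzRingType) (s : R).

(** The Gaussian binomial coefficient of q + K over q at s, as the generating
    function of the partitions with at most K parts, all at most q: the recursion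
    is over the number c of parts equal to q. *)
Fixpoint gauss q K : R :=
  if q is q'.+1 then \sum_(c < K.+1) s ^+ (q * c) * gauss q' (K - c)%N else 1.

Lemma gauss0 q : gauss q 0 = 1.
Proof.
elim: q => //= q IHq; rewrite big_ord_recl big_ord0 muln0 expr0 mul1r addr0.
by rewrite subn0.
Qed.

Lemma gaussS q K : gauss q.+1 K.+1 = gauss q K.+1 + s ^+ q.+1 * gauss q.+1 K.
Proof.
rewrite /= big_ord_recl muln0 expr0 mul1r subn0; congr (_ + _).
rewrite mulr_sumr; apply: eq_bigr => c _.
by rewrite mulrA -exprD mulnS.
Qed.

Arguments gauss : simpl never.

(** By splitting off the factor 1 + z and replacing z by z s in the others. *)
Lemma q_binomial m z : \prod_(i < m) (1 + z * s ^+ i) =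
  \sum_(q < m.+1) z ^+ q * s ^+ 'C(q, 2) * gauss q (m - q)%N.
Proof.
elim: m z => [|m IHm] z.
  by rewrite big_ord0 big_ord_recl big_ord0 expr0 addr0 !mul1r.
rewrite big_ord_recl expr0 mulr1.
have -> : \prod_(i < m) (1 + z * s ^+ bump 0 i) = \prod_(i < m) (1 + z * s * s ^+ i).
  by apply: eq_bigr => i _; rewrite /bump /= add1n exprS mulrA.
rewrite IHm mulrDl mul1r [in RHS]big_ord_recl.
pose a q := z ^+ q * s ^+ q * s ^+ 'C(q, 2) * gauss q (m - q)%N.
have aE q : (z * s) ^+ q * s ^+ 'C(q, 2) * gauss q (m - q)%N = a q by rewrite exprMn.
under eq_bigr do rewrite aE.
rewrite [X in X + _]big_ord_recl [X in z * X]big_ord_recr /=.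
have -> : a 0 = 1 by rewrite /a !expr0 !mul1r.
rewrite !expr0 !mul1r /= -addrA; congr (_ + _).
rewrite mulrDr addrA [RHS]big_ord_recr /=.
congr (_ + _); last first.
  rewrite /a /bump /= add1n !subnn !gauss0 binS bin1 !exprD !exprS; ring.
rewrite mulr_sumr -big_split /=; apply: eq_bigr => q _.
rewrite /a /bump /= !add1n subSS -(@subnSK q m) // gaussS.
rewrite binS bin1 !exprD !exprS; ring.
Qed.

End Gaussian.

Section FfunSums.
Variables (V : nmodType) (T : finType).

Definition snoc q (g : {ffun 'I_q -> T}) (c : T) : {ffun 'I_q.+1 -> T} :=
  [ffun i : 'I_q.+1 => if insub (i : nat) is Some j then g j else c].

Lemma snoc_widen q (g : {ffun 'I_q -> T}) c (j : 'I_q) :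
  snoc g c (widen_ord (leqnSn q) j) = g j.
Proof. by rewrite ffunE /= valK. Qed.

Lemma snoc_max q (g : {ffun 'I_q -> T}) c : snoc g c ord_max = c.
Proof. by rewrite ffunE insubF //= ltnn. Qed.

Lemma sum_snoc q (F : {ffun 'I_q.+1 -> T} -> V) :
  \sum_f F f = \sum_c \sum_g F (snoc g c).
Proof.
rewrite exchange_big pair_bigA /=.
apply: (reindex (fun x => snoc x.1 x.2)).
exists (fun f : {ffun 'I_q.+1 -> T} =>
  ([ffun j : 'I_q => f (widen_ord (leqnSn q) j)], f ord_max)) => [[g c] _|f _] /=.
  rewrite snoc_max; congr pair; apply/ffunP => j; rewrite ffunE; exact: snoc_widen.
apply/ffunP => i; have [j|] := ltnP i q.
  have -> : i = widen_ord (leqnSn q) (Ordinal j) by apply: val_inj.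
  by rewrite snoc_widen ffunE.
move=> le; have -> : i = ord_max by apply/val_inj/anti_leq; rewrite le -ltnS ltn_ord.
by rewrite snoc_max.
Qed.
End FfunSums.

(** Here b i is the number of parts equal to i + 1. *)
Lemma gauss_ffun (R : comNzRingType) (s : R) q K N : (K < N)%N ->
  \sum_(b : {ffun 'I_q -> 'I_N} | (\sum_(i < q) b i <= K)%N)
     s ^+ (\sum_(i < q) i.+1 * b i) = gauss s q K.
Proof.
move=> KN; elim: q K KN => [|q IHq] K KN.
  have i0 : 'I_N := Ordinal KN.
  rewrite (big_pred1 [ffun=> i0]) ?big_ord0 // => b; rewrite big_ord0 leq0n.
  by apply/esym/eqP/ffunP => -[].
rewrite big_mkcond sum_snoc /gauss -/(gauss s q).
rewrite (big_ord_widen N (fun c => s ^+ (q.+1 * c) * gauss s q (K - c)%N)) //.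
rewrite [RHS]big_mkcond; apply: eq_bigr => c _ /=.
rewrite ltnS; case: leqP => cK; last first.
  apply: big1 => g _; rewrite big_ord_recr /= snoc_max ifN // -ltnNge.
  exact: leq_trans cK (leq_addl _ _).
rewrite -IHq; last exact: leq_ltn_trans (leq_subr _ _) KN.
rewrite mulr_sumr [RHS]big_mkcond; apply: eq_bigr => g _ /=.
rewrite !big_ord_recr /= snoc_max.
have -> : (\sum_(i < q) snoc g c (widen_ord (leqnSn q) i) = \sum_(i < q) g i)%N.
  by apply: eq_bigr => i _; rewrite snoc_widen.
have -> : (\sum_(i < q) i.+1 * snoc g c (widen_ord (leqnSn q) i) = \sum_(i < q) i.+1 * g i)%N.
  by apply: eq_bigr => i _; rewrite snoc_widen.
rewrite leq_subRL // addnC; case: ifP => // _.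
by rewrite exprD mulrC.
Qed.

(** Both inner sums of the Hilbert series: all entries of [a] are even, except
    that the last one is odd when [odd_last] holds. Halving the entries leads to
    [gauss_ffun]. *)
Section Inner.
Variables (q k K : nat) (odd_last : bool).
Hypotheses (Kk : (K < k)%N) (q_gt0 : odd_last -> (0 < q)%N).

Let is_last (i : 'I_q) : bool := odd_last && (i.+1 == q).

Lemma sum_last (c : nat -> nat) : (\sum_(i < q) c i.+1 * is_last i = odd_last * c q)%N.
Proof.
rewrite /is_last; case: odd_last q_gt0 => [/(_ isT)|_] /=; last first.
  by rewrite big1 // => i _; rewrite muln0.
case: (q) => // m _; rewrite big_ord_recr /= eqxx muln1 mul1n big1 // => i _.
by rewrite eqSS (ltn_eqF (ltn_ord i)) muln0.
Qed.

Fact double_lt (b : 'I_k) (e : bool) : (e + b.*2 < k + k)%N.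
Proof. by have := ltn_ord b; case: e; lia. Qed.
Fact half_lt (a : 'I_(k + k)) : (a./2 < k)%N.
Proof. by have := ltn_ord a; lia. Qed.

Lemma sum_parity (R : comNzRingType) (x : R) :
  \sum_(a : {ffun 'I_q -> 'I_(k + k)} |
     (\sum_(i < q) a i <= odd_last + K.*2)%N &&
     [forall i : 'I_q, odd (a i) == (odd_last && (i.+1 == q))])
    x ^+ (\sum_(i < q) 2 * i.+1 * a i) =
  x ^+ (odd_last * (2 * q)) * gauss (x ^+ 4) q K.
Proof.
pose h (b : {ffun 'I_q -> 'I_k}) := [ffun i => Ordinal (double_lt (b i) (is_last i))].
pose h' (a : {ffun 'I_q -> 'I_(k + k)}) := [ffun i => Ordinal (half_lt (a i))].
have hE b i : h b i = (is_last i + (b i).*2)%N :> nat by rewrite ffunE.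
rewrite (reindex_onto h h') => [|a /andP[_ /forallP pa]]; last first.
  apply/ffunP => i; apply: val_inj; rewrite /= hE ffunE /= /is_last -(eqP (pa i)).
  exact: odd_double_half.
rewrite -(gauss_ffun _ _ Kk) mulr_sumr; apply: eq_big => [b|b _].
  have -> : h' (h b) == b.
    by apply/eqP/ffunP => i; apply: val_inj; rewrite [h' _ _]ffunE /= hE half_bit_double.
  have -> : [forall i, odd (h b i) == odd_last && (i.+1 == q)].
    by apply/forallP => i; rewrite hE oddD odd_double addbF oddb.
  rewrite !andbT; under eq_bigr do rewrite hE -[nat_of_bool _]mul1n.
  rewrite big_split /= (sum_last (fun=> 1%N)) muln1 leq_add2l.
  under eq_bigr do rewrite -muln2.
  by rewrite -big_distrl /= -muln2 leq_pmul2r.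
rewrite -exprM -exprD; congr (_ ^+ _).
under eq_bigr do rewrite hE mulnDr.
rewrite big_split /= (sum_last (fun j => 2 * j)%N) big_distrr; congr (_ + _)%N.
by apply: eq_bigr => i _ /=; rewrite -muln2; lia.
Qed.
End Inner.

Lemma sum_even_odd (V : nmodType) k (F : nat -> V) :
  \sum_(p < k + k) F p = \sum_(q < k) (F q.*2 + F q.*2.+1).
Proof.
elim: k => [|k IHk]; first by rewrite !big_ord0.
rewrite addSn addnS !big_ord_recr /= -IHk addrA; congr (_ + _ + _).
  by rewrite addnn.
by rewrite addnn.
Qed.

Section Identity.
Variable k : nat.
Local Notation n := (k.+1 + k.+1)%N.
Local Notation x := ('X : {poly int}).

Definition even_term p : {poly int} := x ^+ (p * p.+1)./2 *
  \sum_(a : {ffun 'I_(p./2) -> 'I_n} |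
           (\sum_(i < p./2) a i <= n - p - 1)%N &&
           [forall i : 'I_(p./2), odd (a i) == (i.+1 == p./2)])
      x ^+ (\sum_(i < p./2) 2 * i.+1 * a i).

Definition odd_term p : {poly int} := x ^+ (p * p.+1)./2 *
  \sum_(a : {ffun 'I_(p./2) -> 'I_n} |
           (\sum_(i < p./2) a i <= n - p - 1)%N &&
           [forall i : 'I_(p./2), ~~ odd (a i)])
      x ^+ (\sum_(i < p./2) 2 * i.+1 * a i).

(** The term of index q in the q-binomial expansion of the product of the
    1 + x^5 x^(4i) for i < k; it gives the summand p = 2q of the Hilbert series,
    and x times it gives the summand p = 2q + 1. *)
Definition binom_term q : {poly int} := x ^+ (q * (2 * q + 3)) * gauss (x ^+ 4) q (k - q).

Lemma even_termE q : (0 < q <= k)%N -> even_term q.*2 = binom_term q.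
Proof.
move=> /andP[q0 qk]; rewrite /even_term.
have Kk : (k - (q.*2)./2 < k.+1)%N by lia.
have := @sum_parity (q.*2)./2 k.+1 (k - (q.*2)./2) true Kk _ _ x.
have -> : (n - q.*2 - 1)%N = (true + (k - (q.*2)./2).*2)%N by lia.
move=> ->; last by rewrite doubleK.
rewrite doubleK mulrA -exprD; congr (_ ^+ _ * _).
rewrite -doubleMl doubleK; nia.
Qed.

Lemma odd_termE q : (0 < q <= k)%N -> odd_term q.*2.+1 = x * binom_term q.
Proof.
move=> /andP[q0 qk]; rewrite /odd_term.
set h := (q.*2.+1)./2; have hq : h = q by rewrite /h; lia.
have Kk : (k - h < k.+1)%N by lia.
have := @sum_parity h k.+1 (k - h) false Kk _ _ x.
have -> : (n - q.*2.+1 - 1)%N = (false + (k - h).*2)%N by lia.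
under eq_bigl do under eq_forallb do rewrite andFb eqbF_neg.
move=> -> //; rewrite hq mul0n expr0 mul1r mulrA -exprS; congr (_ ^+ _ * _).
have -> : (q.*2.+1 * q.*2.+2)%N = ((q.*2.+1) * q.+1).*2 by rewrite -doubleS doubleMr.
by rewrite doubleK; nia.
Qed.

Lemma binomial_expansion :
  \prod_(i < k.+1) (1 + x ^+ (4 * i).+1) = (1 + x) * \sum_(q < k.+1) binom_term q.
Proof.
rewrite big_ord_recl muln0 expr1; congr (_ * _).
under eq_bigr => i _.
  rewrite /= /bump add1n mulnS -addSn exprD exprM; over.
rewrite q_binomial; apply: eq_bigr => q _; rewrite -!exprM -exprD.
congr (_ ^+ _ * _).
have := bin2 q; have := odd_double_half (q * q.-1).
have -> : odd (q * q.-1) = false by case: (q : nat) => // m; rewrite oddM /= andNb.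
move=> h b; have {h b} : ('C(q, 2).*2 = q * q.-1)%N by rewrite b; exact: h.
by case: (q : nat) => [|m] /=; lia.
Qed.

Lemma binomial_sum :
  (1 + x) * \sum_(q < k.+1) binom_term q =
  1 + x + \sum_(2 <= p < n | ~~ odd p) even_term p
        + \sum_(3 <= p < n | odd p) odd_term p.
Proof.
have b0 : binom_term 0 = 1 by rewrite /binom_term mul0n expr0 mul1r.
rewrite !big_geq_mkord (big_mkcond (fun i => _ && (2 <= _)%N)).
rewrite (big_mkcond (fun i => _ && (3 <= _)%N)) /=.
rewrite (sum_even_odd _ (fun p => if ~~ odd p && (2 <= p)%N then even_term p else 0)).
rewrite (sum_even_odd _ (fun p => if odd p && (3 <= p)%N then odd_term p else 0)).
rewrite !big_ord_recl b0 /=.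
rewrite !addr0 !add0r mulrDr mulr1 -!addrA; congr (_ + (_ + _)).
rewrite mulrDl mul1r mulr_sumr; congr (_ + _); apply: eq_bigr => q _.
  by rewrite /bump /= add1n odd_double /= addr0 even_termE // ltn_ord.
by rewrite /bump /= add1n odd_double /= add0r odd_termE // ltn_ord.
Qed.

End Identity.

Lemma hilbert_identity k : (1 <= k)%N -> let n := (k + k)%N in
  \prod_(i < k) (1 + 'X^((4 * i).+1)) =
    1 + 'X
    + \sum_(2 <= p < n | ~~ odd p)
        'X^((p * p.+1)./2) *
        (\sum_(a : {ffun 'I_(p./2) -> 'I_n} |
                 (\sum_(i < p./2) a i <= n - p - 1)%N &&
                 [forall i : 'I_(p./2), odd (a i) == (i.+1 == p./2)])
            'X^(\sum_(i < p./2) 2 * i.+1 * a i))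
    + \sum_(3 <= p < n | odd p)
        'X^((p * p.+1)./2) *
        (\sum_(a : {ffun 'I_(p./2) -> 'I_n} |
                 (\sum_(i < p./2) a i <= n - p - 1)%N &&
                 [forall i : 'I_(p./2), ~~ odd (a i)])
            'X^(\sum_(i < p./2) 2 * i.+1 * a i)) :> {poly int}.
Proof. by case: k => // k _ n; rewrite binomial_expansion binomial_sum. Qed.

Unset Implicit Arguments.

(* In the inner sums, a : {ffun 'I_(p./2) -> 'I_n} has a_(i+1) as its value at
   i; the bound on the sum of the a_i forces each a_i < n. *)
Theorem proposition7p3 (R : realType) (k : nat) (hk : (1 <= k)%N) :
  let n := (k + k)%N in
  hilbert_ext_inv (@ext2_act R[i] n) (Sp R[i] k) =
    1 + 'X
    + \sum_(2 <= p < n | ~~ odd p)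
        'X^((p * p.+1)./2) *
        (\sum_(a : {ffun 'I_(p./2) -> 'I_n} |
                 (\sum_(i < p./2) a i <= n - p - 1)%N &&
                 [forall i : 'I_(p./2), odd (a i) == (i.+1 == p./2)])
            'X^(\sum_(i < p./2) 2 * i.+1 * a i))
    + \sum_(3 <= p < n | odd p)
        'X^((p * p.+1)./2) *
        (\sum_(a : {ffun 'I_(p./2) -> 'I_n} |
                 (\sum_(i < p./2) a i <= n - p - 1)%N &&
                 [forall i : 'I_(p./2), ~~ odd (a i)])
            'X^(\sum_(i < p./2) 2 * i.+1 * a i)).

Proof. by move=> n; rewrite hilbert_Sp // hilbert_identity. Qed.
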